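(* Fix $k\in\mathbb N$ and $t\in\mathbb N_0$ and let $(Z^{(1:k)}[t],A^{(1:k,1:k)}[t])$ be the limiting mean-field process defined in the context. Then: 1. the $\mathcal M_t(\mathbb R^d)$-random elements $Z^{(i)}[t]$, $i\in[1:k]$, are i.i.d.; 2. for every $s\in[t]$, the random variables $A^{(ij)}(s)$, $(i,j)\in\mathcal I_k$, are conditionally independent given $\mathcal H^k_s$, with $$\mathbb E[A^{(ij)}(s)\mid\mathcal H^k_s]=\mathbb E[A^{(ij)}(s)\mid\mathcal G^{A,k}_s];$$ 3. for every $s\in[t]$ (and $(i,j)\in\mathcal I_k$), $$\mathbb E[A^{(ij)}(s)\mid\mathcal G^k_s]=B_s\big(Z^{(i)}[s],Z^{(j)}[s]\big).$$
   Context: **Notation.** $[t]=\{0,\dots,t\}$, $[1:k]=\{1,\dots,k\}$, $\mathcal I_k=\{(i,j):1\le i<j\le k\}$; $\mathcal M_t(\mathcal X)$ is the space of functions $[t]\to\mathcal X$; for a trajectory $x$, $x[s]=(x(0),\dots,x(s))$. **Data.** $d\in\mathbb N$, $\gamma\in(0,1)$; a.e. continuous functions $B:\{0,1\}\times\mathbb R^d\times\mathbb R^d\to[0,1]$ and $B_0:\mathbb R^d\times\mathbb R^d\to[0,1]$, symmetric in the two $\mathbb R^d$-arguments; an absolutely continuous probability measure $\mu_0$ on $\mathbb R^d$; an absolutely continuous noise law on $\mathbb R^d$. Let $\widehat B(p,x,y)=pB(1,x,y)+(1-p)B(0,x,y)$ and, for trajectories $z_1,z_2$, recursively $B_s(z_1[s],z_2[s])=\widehat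 B\big(B_{s-1}(z_1[s-1],z_2[s-1]),z_1(s),z_2(s)\big)$ for $s>0$, starting from $B_0(z_1(0),z_2(0))$. **$\sigma$-algebras.** $\mathcal F^k_s=\sigma(Z^{(1:k)}[s],A^{(1:k,1:k)}[s])$, $\mathcal G^k_s=\sigma(Z^{(1:k)}[s])$. For $s>0$: $\mathcal G^{A,k}_s=\sigma(Z^{(1:k)}[s],A^{(1:k,1:k)}[s-1])$ and $\mathcal H^k_s=\sigma(Z^{(1:k)}(s),A^{(1:k,1:k)}(s-1))$. For $s=0$: $\mathcal G^{A,k}_0=\mathcal H^k_0=\sigma(Z^{(1:k)}(0))$. **Limiting mean-field process.** $Z^{(i)}(0)$, $i\in[1:k]$, are i.i.d. with law $\mu_0$. For each $i$, $Z^{(i)}$ solves $$Z^{(i)}(s+1)=(1-\gamma)Z^{(i)}(s)+\gamma L^{(i)}(s)+\xi_i(s),\qquad L^{(i)}(s)=\frac{\int z(s)\,B_s(Z^{(i)}[s],z)\,\mu_s(dz)}{\int B_s(Z^{(i)}[s],z)\,\mu_s(dz)},$$ where $\mu_s=\mathrm{Law}(Z^{(1)}[s])$ (it being part of the requirement that the quotient is a.s. well defined), $\{\xi_i(s)\}$ are i.i.d. with the noise law, and for each $s$, $\xi_{1:k}(s)$ is independent of $\mathcal F^k_s$. For $i\ne j$, $A^{(ij)}(s)$ is $\{0,1\}$-valued with $$\mathbb E[A^{(ij)}(s)\mid\mathcal G^{A,k}_s]=\begin{cases} B(A^{(ij)}(s-1),Z^{(i)}(s),Z^{(j)}(s)),&s>0,\\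 B_0(Z^{(i)}(0),Z^{(j)}(0)),&s=0,\end{cases}$$ $A^{(ij)}[t]=A^{(ji)}[t]$, $A^{(ii)}(s)=1$ for all $s\in[t]$. Finally the process has any one of the following (equivalent) conditional structures: (a) for each $s\in[t]$, $\{A^{(ij)}(s)\}_{(i,j)\in\mathcal I_k}$ are mutually conditionally independent given $\mathcal G^{A,k}_s$; (b) the trajectories $\{A^{(ij)}[t]\}_{(i,j)\in\mathcal I_k}$ are mutually conditionally independent given $\mathcal G^k_t$, and each $A^{(ij)}[t]$ is a conditional Markov chain given $\mathcal G^k_t$ with $\mathbb P(A^{(ij)}(0)=1\mid\mathcal G^k_t)=B_0(Z^{(i)}(0),Z^{(j)}(0))$ and $\mathbb P(A^{(ij)}(s)=1\mid\mathcal G^k_t,A^{(ij)}(s-1)=a)=B(a,Z^{(i)}(s),Z^{(j)}(s))$ for $s>0$; (c) for every $s\in[t]$ the trajectories $\{A^{(ij)}[s]\}_{(i,j)\in\mathcal I_k}$ are mutually conditionally independent given $\mathcal G^k_s$. *)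

(* Defs.v *)
From HB Require Import structures.
From mathcomp Require Import all_boot all_order all_algebra.
From mathcomp Require Import all_classical all_reals all_analysis.

Set Implicit Arguments.
Unset Strict Implicit.
Unset Printing Implicit Defensive.

Import Order.TTheory GRing.Theory Num.Theory.
Import numFieldNormedType.Exports.

Local Open Scope classical_set_scope.
Local Open Scope ring_scope.

(* Matrices, in particular the row vectors 'rV[R]_d standing for R^d, carry the
   product sigma-algebra, generated by the entries; over a realType this is the
   Borel sigma-algebra. *)

Definition measure_matrix_display : measure_display -> measure_display.
Proof. exact. Qed.

Definition matrix_measurable d (T : measurableType d) m n :
    set (set 'M[T]_(m, n)) :=
  <<s \bigcup_ij preimage_set_system setT
        (fun M : 'M[T]_(m, n) => M ij.1 ij.2) measurable >>.

Section matrix_measurable.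
Context d (T : measurableType d) (m n : nat).

Let matrix_measurableC A :
  @matrix_measurable d T m n A -> matrix_measurable (~` A).
Proof. exact: sigma_algebraC. Qed.

HB.instance Definition _ :=
  @isMeasurable.Build (measure_matrix_display d) 'M[T]_(m, n)
    (@matrix_measurable d T m n) (@sigma_algebra0 _ _ _)
    matrix_measurableC (@sigma_algebra_bigcup _ _ _).

End matrix_measurable.

Lemma measurable_entry d (T : measurableType d) m n i j :
  measurable_fun [set: 'M[T]_(m, n)] (fun M : 'M[T]_(m, n) => M i j).
Proof.
move=> _ Y mY; rewrite setTI; apply: sub_sigma_algebra.
by exists (i, j) => //; exists Y => //; rewrite setTI.
Qed.

Lemma measurable_fun_matrix d d' (U : measurableType d') (T : measurableType d)
    m n (f : U -> 'M[T]_(m, n)) :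
  (forall i j, measurable_fun [set: U] (fun u => f u i j)) ->
  measurable_fun [set: U] f.
Proof.
move=> mf; have sub : @matrix_measurable d T m n `<=`
    image_set_system setT f (@measurable _ U).
  apply: smallest_sub.
    by apply: sigma_algebra_image; exact: sigma_algebra_measurable.
  move=> A [[i j] _ [B mB <-]] /=; rewrite setTI.
  exact: mf.
by move=> _ A mA; exact: sub.
Qed.

(* Lebesgue measure on R^d, by recursion on d: a point mass for d = 0, and the
   product of the Lebesgue measures on R and on R^d for d.+1. *)

Section lebesgue_rV.
Context (R : realType).

Definition rV_cons d (p : measurableTypeR R * 'rV[R]_d) : 'rV[R]_d.+1 :=
  \row_i oapp (p.2 0) p.1 (unlift ord0 i).

Definition rV_uncons d (v : 'rV[R]_d.+1) : measurableTypeR R * 'rV[R]_d :=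
  (v 0 ord0, \row_i v 0 (lift ord0 i)).

Lemma rV_consK d : cancel (@rV_cons d) (@rV_uncons d).
Proof.
move=> [x v]; congr pair; rewrite /rV_cons/=; first by rewrite mxE unlift_none.
by apply/rowP => i; rewrite !mxE liftK.
Qed.

Lemma measurable_rV_cons d : measurable_fun setT (@rV_cons d).
Proof.
apply: measurable_fun_matrix => i j; rewrite /rV_cons.
under eq_fun do rewrite mxE.
case: unliftP => [l|] _ /=; last exact: measurable_fst.
apply: (measurableT_comp (f := fun v : 'rV[R]_d => v 0 l)) => //.
exact: measurable_entry.
Qed.

Lemma measurable_rV_uncons d : measurable_fun setT (@rV_uncons d).
Proof.
apply: measurable_fun_pair; first exact: measurable_entry.
apply: measurable_fun_matrix => i j; under eq_fun do rewrite mxE.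
exact: measurable_entry.
Qed.

Definition lebesgue_cons d (m : {sigma_finite_measure set 'rV[R]_d -> \bar R}) :
    set 'rV[R]_d.+1 -> \bar R :=
  pushforward (@lebesgue_measure R \x m)%E (@rV_cons d).


Section lebesgue_cons.
Context d (m : {sigma_finite_measure set 'rV[R]_d -> \bar R}).

Let measurable_preimage A : measurable A -> measurable (@rV_cons d @^-1` A).
Proof.
by move=> mA; rewrite -[X in measurable X]setTI; exact: measurable_rV_cons.
Qed.

Let lebesgue_cons0 : lebesgue_cons m set0 = 0%E.
Proof. by rewrite /lebesgue_cons /pushforward preimage_set0 measure0. Qed.

Let lebesgue_cons_ge0 A : (0 <= lebesgue_cons m A)%E.
Proof. by rewrite /lebesgue_cons /pushforward measure_ge0. Qed.

Let lebesgue_cons_sigma_additive : semi_sigma_additive (lebesgue_cons m).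
Proof.
move=> F mF tF mUF; rewrite /lebesgue_cons /pushforward preimage_bigcup.
apply: measure_semi_sigma_additive.
- by move=> n; exact: measurable_preimage.
- apply/trivIsetP => /= i j _ _ ij; rewrite -preimage_setI.
  by move/trivIsetP : tF => /(_ _ _ _ _ ij) ->//; rewrite preimage_set0.
- by rewrite -preimage_bigcup; exact: measurable_preimage.
Qed.

HB.instance Definition _ := isMeasure.Build _ _ _ (lebesgue_cons m)
  lebesgue_cons0 lebesgue_cons_ge0 lebesgue_cons_sigma_additive.

Let lebesgue_cons_sigma_finite : sigma_finite setT (lebesgue_cons m).
Proof.
have /sigma_finiteP[F [TF ndF Foo]] := sigma_finiteT (@lebesgue_measure R).
have /sigma_finiteP[G [TG ndG Goo]] := sigma_finiteT m.
exists (fun n => @rV_uncons d @^-1` (F n `*` G n)).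
  apply/esym; rewrite -subTset => v _.
  have [i _ Fi] : (\bigcup_i F i) (rV_uncons v).1 by rewrite -TF.
  have [j _ Gj] : (\bigcup_j G j) (rV_uncons v).2 by rewrite -TG.
  exists (maxn i j) => //; split.
  - by move: Fi; exact/subsetPset/ndF/leq_maxl.
  - by move: Gj; exact/subsetPset/ndG/leq_maxr.
move=> n; have [mF Fnoo] := Foo n; have [mG Gnoo] := Goo n; split.
  rewrite -[X in measurable X]setTI; apply: measurable_rV_uncons => //.
  exact: measurableX.
rewrite /lebesgue_cons /pushforward -comp_preimage.
rewrite (_ : _ \o _ = id); last by apply/funext => p /=; rewrite rV_consK.
by rewrite preimage_id product_measure1E// lte_mul_pinfty// ge0_fin_numE.
Qed.

HB.instance Definition _ := Measure_isSigmaFinite.Build _ _ _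
  (lebesgue_cons m) lebesgue_cons_sigma_finite.

End lebesgue_cons.

Fixpoint lebesgue_rV d : {sigma_finite_measure set 'rV[R]_d -> \bar R} :=
  match d with
  | 0 => [the {sigma_finite_measure set _ -> \bar R} of \d_(0 : 'rV[R]_0)]
  | d'.+1 => [the {sigma_finite_measure set _ -> \bar R}
              of lebesgue_cons (lebesgue_rV d')]
  end.

End lebesgue_rV.

Section sigma_algebras.
Context disp (T : measurableType disp).

Definition sigma_join (F G : set (set T)) : set (set T) := <<s F `|` G >>.

Definition sigma_rvs disp' (U : measurableType disp') (I : Type)
    (X : I -> T -> U) : set (set T) :=
  <<s \bigcup_i g_sigma_algebra_preimage (X i) >>.

End sigma_algebras.

Section conditioning.
Context (R : realType) disp (T : measurableType disp) (P : probability T R).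

(* E[X | G] = Y almost surely: Y coincides P-a.e. with a G-measurable version of
   the conditional expectation.  Y itself need not be G-measurable, since the
   functions B and B_0, being only a.e. continuous, need not be Borel. *)
Definition condexp_eq (G : set (set T)) (X Y : T -> R) : Prop :=
  exists V : T -> R,
    [/\ g_sigma_algebra_preimage V `<=` G,
        P.-integrable setT (EFin \o V),
        forall E, G E ->
          (\int[P]_(w in E) (V w)%:E = \int[P]_(w in E) (X w)%:E)%E
      & {ae P, forall w, Y w = V w}].

Context disp' (U : measurableType disp').

Definition mutually_independent (I : finType) (X : I -> T -> U) : Prop :=
  forall E : I -> set U, (forall i, measurable (E i)) ->
    P (\bigcap_i (X i @^-1` E i)) = (\prod_i P (X i @^-1` E i))%E.

Definition identically_distributed (I : Type) (X : I -> T -> U) : Prop :=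
  forall i j (E : set U), measurable E -> P (X i @^-1` E) = P (X j @^-1` E).

Definition has_law (X : T -> U) (nu : probability U R) : Prop :=
  forall E : set U, measurable E -> P (X @^-1` E) = nu E.

Definition independent_of_sigma (X : T -> U) (G : set (set T)) : Prop :=
  forall (E : set U) F, measurable E -> G F ->
    P (X @^-1` E `&` F) = (P (X @^-1` E) * P F)%E.

(* Conditional independence given G of the family (X i) indexed by J. *)
Definition cond_independent (I : finType) (J : pred I) (G : set (set T))
    (X : I -> T -> U) : Prop :=
  forall E : I -> set U, (forall i, measurable (E i)) ->
    exists Q : I -> T -> R,
      (forall i, J i -> condexp_eq G \1_(X i @^-1` E i) (Q i)) /\
      condexp_eq G \1_(\bigcap_(i in [set i | J i]) (X i @^-1` E i))
        (fun w => \prod_(i | J i) Q i w).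

End conditioning.

Section trajectories.
Context disp disp' (T : measurableType disp) (U : measurableType disp').

Definition traj s (X : nat -> {mfun T >-> U}) (w : T) : s.+1.-tuple U :=
  [tuple X r w | r < s.+1].

Let measurable_traj s X : measurable_fun setT (traj s X).
Proof.
apply/measurable_fun_tnthP => i.
rewrite (_ : _ \o _ = X i) //.
by apply/funext => w /=; rewrite tnth_mktuple.
Qed.

HB.instance Definition _ s X :=
  isMeasurableFun.Build _ _ _ _ (traj s X) (@measurable_traj s X).

End trajectories.

Section mean_field.
Context (R : realType) (d : nat).
Local Notation Rd := 'rV[R]_d.

Definition connection_function (f : Rd -> Rd -> R) : Prop :=
  [/\ forall x y, 0 <= f x y <= 1,
      forall x y, f x y = f y x
    & {ae (lebesgue_rV R d \x lebesgue_rV R d)%E,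
        forall z, {for z, continuous (fun z : Rd * Rd => f z.1 z.2)}}].

Context (gamma : R) (B : bool -> Rd -> Rd -> R) (B0 : Rd -> Rd -> R).

Definition Bhat (p : R) (x y : Rd) : R :=
  p * B true x y + (1 - p) * B false x y.

Fixpoint Btraj s (z1 z2 : seq Rd) : R :=
  match s with
  | 0 => B0 z1`_0 z2`_0
  | s'.+1 => Bhat (Btraj s' z1 z2) z1`_s z2`_s
  end.

Section mean_field_average.
Context s (mu : probability (s.+1.-tuple Rd) R) (x : s.+1.-tuple Rd).

Definition mean_field_average : Rd :=
  \row_l ((\int[mu]_z (z`_s 0 l * Btraj s x z)) / (\int[mu]_z Btraj s x z)).

Definition mean_field_average_defined : Prop :=
  \int[mu]_z Btraj s x z != 0 /\
  forall l, (\int[mu]_z `| z`_s 0 l * Btraj s x z |%:E < +oo)%E.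

End mean_field_average.

Context disp (T : measurableType disp) (P : probability T R) (k : nat)
  (Z : 'I_k -> nat -> {RV P >-> Rd})
  (A : 'I_k -> 'I_k -> nat -> {RV P >-> bool}).

Definition edges : pred ('I_k * 'I_k) := [pred e : 'I_k * 'I_k | (e.1 < e.2)%N].

Definition sigmaG s : set (set T) := sigma_rvs (fun i => traj s (Z i)).

Definition sigmaF s : set (set T) :=
  sigma_join (sigmaG s) (sigma_rvs (fun e : 'I_k * 'I_k => traj s (A e.1 e.2))).

Definition sigmaGA s : set (set T) :=
  match s with
  | 0 => sigma_rvs (fun i => Z i 0%N)
  | s'.+1 => sigma_join (sigmaG s)
               (sigma_rvs (fun e : 'I_k * 'I_k => traj s' (A e.1 e.2)))
  end.

Definition sigmaH s : set (set T) :=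
  match s with
  | 0 => sigma_rvs (fun i => Z i 0%N)
  | s'.+1 => sigma_join (sigma_rvs (fun i => Z i s))
                        (sigma_rvs (fun e : 'I_k * 'I_k => A e.1 e.2 s'))
  end.

Definition edge_value i j s (w : T) : R := (A i j s w)%:R.

Definition edge_prob i j s (w : T) : R :=
  match s with
  | 0 => B0 (Z i 0%N w) (Z j 0%N w)
  | s'.+1 => B (A i j s' w) (Z i s w) (Z j s w)
  end.

Context (t : nat).

Definition cond_structure_a : Prop :=
  forall s, (s <= t)%N ->
    cond_independent P edges (sigmaGA s) (fun e => A e.1 e.2 s).

(* The last two clauses are the conditional Markov property and the
   transition law: conditioning on G^k_t together with A^{ij}[s] amounts to
   conditioning on G^k_t together with A^{ij}(s), and the resulting probability
   on {A^{ij}(s) = a} is B(a, Z^i(s+1), Z^j(s+1)). *)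
Definition cond_structure_b : Prop :=
  cond_independent P edges (sigmaG t) (fun e => traj t (A e.1 e.2)) /\
  forall i j : 'I_k, (i < j)%N ->
    [/\ condexp_eq P (sigmaG t) (edge_value i j 0) (edge_prob i j 0),
        forall s, (s < t)%N -> forall a : bool, exists Q : T -> R,
          condexp_eq P
            (sigma_join (sigmaG t) (g_sigma_algebra_preimage (traj s (A i j))))
            \1_(A i j s.+1 @^-1` [set a]) Q /\
          condexp_eq P
            (sigma_join (sigmaG t) (g_sigma_algebra_preimage (A i j s)))
            \1_(A i j s.+1 @^-1` [set a]) Q
      & forall s, (s < t)%N ->
          condexp_eq P
            (sigma_join (sigmaG t) (g_sigma_algebra_preimage (A i j s)))
            (edge_value i j s.+1) (edge_prob i j s.+1)].

Definition cond_structure_c : Prop :=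
  forall s, (s <= t)%N ->
    cond_independent P edges (sigmaG s) (fun e => traj s (A e.1 e.2)).

(* The process is only constrained at times s <= t, and the noise at times
   s < t; i1 is the particle whose law enters the dynamics. *)
Record mean_field_process (i1 : 'I_k) (mu0 nu : probability Rd R)
    (xi : 'I_k -> nat -> {RV P >-> Rd}) : Prop := {
  init_independent : mutually_independent P (fun i => Z i 0%N);
  init_law : forall i, has_law P (Z i 0%N) mu0;
  noise_independent :
    mutually_independent P (fun q : 'I_k * 'I_t => xi q.1 q.2 : T -> Rd);
  noise_law : forall i s, (s < t)%N -> has_law P (xi i s) nu;
  noise_independent_of_past : forall s, (s < t)%N ->
    independent_of_sigma P
      (fun w => [tuple xi i s w | i < k] : k.-tuple Rd) (sigmaF s);
  average_defined : forall i s, (s < t)%N ->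
    {ae P, forall w, mean_field_average_defined
      (distribution P (traj s (Z i1))) (traj s (Z i) w)};
  dynamics : forall i s, (s < t)%N ->
    {ae P, forall w, Z i s.+1 w =
      (1 - gamma) *: Z i s w
      + gamma *: mean_field_average
                   (distribution P (traj s (Z i1))) (traj s (Z i) w)
      + xi i s w};
  edge_law : forall i j s, i != j -> (s <= t)%N ->
    condexp_eq P (sigmaGA s) (edge_value i j s) (edge_prob i j s);
  edge_sym : forall i j s, (s <= t)%N ->
    {ae P, forall w, A i j s w = A j i s w};
  edge_diag : forall i s, (s <= t)%N -> {ae P, forall w, A i i s w = true};
  edge_structure :
    cond_structure_a \/ cond_structure_b \/ cond_structure_c
}.

End mean_field.

(* Main.v *)
(* B and B_0 are only a.e. continuous, hence agree a.e. with Borel functions. The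
   laws of the positions stay absolutely continuous, because the noise law is, so
   the Borel versions may replace B and B_0 for pairs of distinct particles and
   inside the mean-field averages.

   (1) The average is then a fixed measurable function of the path of the
   particle, so the path until s+1 is a function, the same for all particles, of
   the path until s and of the noise at s: being i.i.d. propagates in s.

   (3) If D is bounded, F_s-measurable and has zero integral over the events of
   G_s, then it has zero integral over the events of G_r for all later r, because
   Z[r] is a function of Z[s] and of noise independent of F_s. Since the
   transition probability is affine in the state of the edge, the recursion
   defining B_s follows.

   (2) E[A(s) | G^A_s] is H_s-measurable, so it is enough that the edges multiply
   given G^A_s. This is structure (a). Under (b) or (c) the trajectories of the
   edges are independent given G_t; intersecting with a fixed past of the edges
   and passing from G_t to G_s as in (3) gives (a). *)
Require Import Defs.
From mathcomp Require Import all_boot all_order all_algebra.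
From mathcomp Require Import all_classical all_reals all_analysis.
From mathcomp Require Import measurable_realfun lra ring.

Set Implicit Arguments.
Unset Strict Implicit.
Unset Printing Implicit Defensive.

Import Order.TTheory GRing.Theory Num.Theory.
Import numFieldNormedType.Exports.

Local Open Scope classical_set_scope.
Local Open Scope ring_scope.

(** Conditional expectations are not constructed. A statement such as E[D | G] = 0 is kept as the
    vanishing of the integrals of [D] over the events of [G], and [Rintegral0_mul] is the rule for
    taking out a bounded [G]-measurable factor. Changing the conditioning then means changing the
    family of test events.

    The delicate point is to reach (a) from (b) or (c): there independence is given [sigmaG t],
    while (a) conditions on [sigmaGA s], which mixes positions with past edges. The past of the
    edges takes finitely many values, and on each of them [sigmaGA s] reduces to [sigmaG s] up to
    null events. For one edge with a prescribed past, the law at time [s] is known over [sigmaG s];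
    [innovation] raises it to [sigmaG t], where independence multiplies the edges, and the product
    is then tested on events of [sigmaG s]. Probabilities of past and present are compared with
    those of the past by multiplication, so that pasts of conditional probability zero need no
    separate treatment.

    Null events enter because the dynamics, the symmetry and the diagonal convention hold almost
    surely only. *)

Notation "G .-measurable_fun f" :=
  (measurable_fun [set: g_sigma_algebraType G] (f : g_sigma_algebraType G -> _))
  (at level 2, f at level 9, format "G .-measurable_fun  f").

(** * Sub-sigma-algebras and vanishing integrals *)

Section zero_integrals.
Context d (T : measurableType d) (R : realType) (P : probability T R).
Implicit Types (c : R) (D W : T -> R) (C G : set_system T).

Lemma g_sigma_algebra_sub C : C `<=` measurable -> <<s C >> `<=` measurable.
Proof.
by move=> Cm; apply: smallest_sub => //; exact: sigma_algebra_measurable.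
Qed.

Lemma measurable_fun_g_sigma d' (U : measurableType d') C (f : T -> U) :
  C `<=` measurable -> C.-measurable_fun f -> measurable_fun setT f.
Proof.
by move=> Cm mf _ E mE; apply: (g_sigma_algebra_sub Cm); exact: mf.
Qed.

Lemma integrable_mul_bounded D W c : P.-integrable setT (EFin \o D) ->
  measurable_fun setT W -> (forall w, `|W w| <= c) ->
  P.-integrable setT (EFin \o (fun w => D w * W w)).
Proof.
move=> iD mW Wc.
have iD' := @integrableZl _ _ _ P setT measurableT c _ iD.
apply: le_integrable iD' => //.
  apply/measurable_EFinP; apply: measurable_funM => //.
  by apply/measurable_EFinP; case/integrableP : iD.
move=> w _ /=; rewrite lee_fin !normrM mulrC ler_wpM2r//.
by rewrite (le_trans (Wc w))// ler_norm.
Qed.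

Lemma integrable_bounded W c : measurable_fun setT W ->
  (forall w, `|W w| <= c) -> P.-integrable setT (EFin \o W).
Proof.
move=> mW Wc.
have i1 : P.-integrable setT (EFin \o (cst 1 : T -> R)).
  by apply: finite_measure_integrable_cst.
apply: eq_integrable (integrable_mul_bounded i1 mW Wc) => // w _ /=.
by rewrite mul1r.
Qed.

Lemma Rintegral_indicM D S : measurable S ->
  \int[P]_w (D w * \1_S w) = \int[P]_(w in S) D w.
Proof.
move=> mS; rewrite [RHS]Rintegral_mkcond; apply: eq_Rintegral => w _.
by rewrite patchE indicE; case: ifPn => wS; rewrite ?mulr1 ?mulr0.
Qed.

Lemma EFin_Rintegral D S : measurable S -> P.-integrable setT (EFin \o D) ->
  ((\int[P]_(w in S) D w)%:E = \int[P]_(w in S) (D w)%:E)%E.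
Proof.
move=> mS iD; rewrite /Rintegral fineK//; apply: integrable_fin_num => //.
exact: integrableS iD.
Qed.

Lemma ae_eq_Rintegral D1 D2 : measurable_fun setT D1 -> measurable_fun setT D2 ->
  {ae P, forall w, D1 w = D2 w} -> \int[P]_w D1 w = \int[P]_w D2 w.
Proof.
move=> m1 m2 D12; congr fine; apply: ae_eq_integral => //.
- exact/measurable_EFinP.
- exact/measurable_EFinP.
- by apply: filterS D12 => w /= ->.
Qed.

Lemma integrable_Rsum (I : finType) (f : I -> T -> R) :
  (forall i, P.-integrable setT (EFin \o f i)) ->
  P.-integrable setT (EFin \o (fun w => \sum_i f i w)).
Proof.
move=> fi; have := @integrable_sum _ _ _ P _ measurableT _
  (index_enum I) xpredT (fun i => EFin \o f i) (fun i _ => fi i).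
by apply: eq_integrable => // w _ /=; rewrite sumEFin.
Qed.

Lemma Rintegral_sum (I : finType) (f : I -> T -> R) :
  (forall i, P.-integrable setT (EFin \o f i)) ->
  \int[P]_w (\sum_i f i w) = \sum_i \int[P]_w f i w.
Proof.
move=> fi; apply: EFin_inj; rewrite EFin_Rintegral//; last first.
  exact: integrable_Rsum.
under eq_integral do rewrite -sumEFin.
rewrite integral_sum// -sumEFin; apply: eq_bigr => i _.
by rewrite EFin_Rintegral.
Qed.

(** The measurable sets over which [D] has zero integral form a Dynkin class: complements use that
    the total integral vanishes, disjoint unions use integrability. Hence a generating pi-system
    decides. *)
Lemma Rintegral0_dynkin C D : C `<=` measurable -> setI_closed C ->
  P.-integrable setT (EFin \o D) -> \int[P]_w D w = 0 ->
  (forall S, C S -> \int[P]_(w in S) D w = 0) ->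
  forall S, <<s C >> S -> \int[P]_(w in S) D w = 0.
Proof.
move=> Cm CI iD D0 CD S; rewrite -setI_closed_g_dynkin_g_sigma_algebra//.
suff: <<d C >> `<=` [set A | measurable A /\ \int[P]_(w in A) D w = 0].
  by move=> /(_ S) h /h[].
apply: smallest_sub => [|A CA]; last by split; [exact: Cm|exact: CD].
split => //.
- move=> A [mA A0]; split; first exact: measurableC.
  have := D0; rewrite -(setUv A) Rintegral_setU//.
  + by rewrite A0 add0r.
  + exact: measurableC.
  + by rewrite setUv.
  + by rewrite disj_set2E setICr.
- move=> F tF mF; split; first by apply: bigcupT_measurable => n; case: (mF n).
  rewrite /Rintegral integral_bigcup//.
  + rewrite eseries0// => n _ _.
    rewrite -EFin_Rintegral//; last by case: (mF n).
    by rewrite (mF n).2.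
  + by move=> n; case: (mF n).
  + apply: integrableS iD => //.
    by apply: bigcupT_measurable => n; case: (mF n).
Qed.

(** The sum counts the positive integers up to [x], so it is the integer part of [x]. It is the
    staircase that discretizes the weight in [Rintegral0_mul]. *)
Lemma sum_indic_le n (x : R) : 0 <= x <= n%:R ->
  `|x - \sum_(i < n) (i.+1%:R <= x)%R%:R| <= 1.
Proof.
elim: n x => [|n ih] x /andP[x0 xn].
  by rewrite big_ord0 subr0 ger0_norm// (le_trans xn)// ler01.
rewrite big_ord_recr/=; have [xn'|nx] := leP x n%:R.
  have [|_] := leP n.+1%:R x.
    by move=> /le_trans/(_ xn'); rewrite ler_nat ltnn.
  by rewrite addr0 ih// x0.
under eq_bigr => i _.
  have -> : (i.+1%:R <= x)%R by rewrite (le_trans _ (ltW nx))// ler_nat.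
  over.
have nE : n.+1%:R = n%:R + 1 :> R by rewrite natr1.
rewrite sumr_const card_ord.
by case: (leP n.+1%:R x) => h; rewrite ?mulr1n ?mulr0n ler_norml; apply/andP; split; lra.
Qed.

(** The level sets of [W] lie in [G], so [D] has zero integral against every combination of their
    indicators, and such combinations approximate [W] uniformly. This is the pull-out rule: E[D | G]
    = 0 implies E[D W] = 0. *)
Lemma Rintegral0_mul G D W c : sigma_algebra setT G -> G `<=` measurable ->
  P.-integrable setT (EFin \o D) ->
  (forall S, G S -> \int[P]_(w in S) D w = 0) ->
  G.-measurable_fun W -> (forall w, `|W w| <= c) ->
  \int[P]_w (D w * W w) = 0.
Proof.
move=> sG Gm iD D0 mW Wc.
have mWT : measurable_fun setT W by exact: measurable_fun_g_sigma mW.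
wlog W01 : W c Wc mW mWT / forall w, 0 <= W w <= 1.
  (* An affine change of [W] maps its range into the unit interval; the added 1 keeps [a] positive
     when [c] is 0. The shift contributes a multiple of the total integral of [D], which is zero. *)
  move=> wl; pose a := `|c| + 1; have a0 : 0 < a by rewrite ltr_wpDl.
  pose U w := (W w + a) / (2 * a).
  have mU : G.-measurable_fun U.
    by apply: measurable_funM => //; apply: measurable_funD.
  have mUT : measurable_fun setT U by exact: measurable_fun_g_sigma mU.
  have U01 w : 0 <= U w <= 1.
    have : `|W w| <= a by rewrite (le_trans (Wc w))// (le_trans (ler_norm c))// lerDl.
    rewrite ler_norml => /andP[h1 h2]; rewrite /U; apply/andP; split.
      by apply: divr_ge0; [lra|rewrite mulr_ge0// ltW].
    by rewrite ler_pdivrMr ?mulr_gt0//; lra.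
  have U1 w : `|U w| <= 1 by rewrite ger0_norm; case/andP: (U01 w).
  have iU := integrable_mul_bounded iD mUT U1.
  have -> : \int[P]_w (D w * W w) =
      \int[P]_w ((2 * a) * (D w * U w) - a * D w).
    apply: eq_Rintegral => w _; rewrite /U; field.
    by rewrite gt_eqF.
  rewrite RintegralB//; last 2 first.
  - exact: (@integrableZl _ _ _ P _ measurableT (2 * a) _ iU).
  - exact: (@integrableZl _ _ _ P _ measurableT a _ iD).
  rewrite !RintegralZl// (wl U 1)// D0 ?subrr ?mulr0 ?subr0//.
  by rewrite -setC0 -setTD; case: sG => G0 GC _; exact: GC.
have GE : <<s G>> = G by exact: sigma_algebra_id.
have Gle (r : R) : G [set w | r <= W w].
  rewrite -GE (_ : [set w | r <= W w] = setT `&` (W @^-1` `[r, +oo[)).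
    exact: mW.
  by apply/seteqP; split => w /=; rewrite in_itv/= andbT// => -[].
have iT : P.-integrable setT (EFin \o (fun w => `|D w|)).
  exact: integrable_norm iD.
(* [W] is within [n.+1^-1] of [n.+1^-1] times the number of levels
   [i.+1 / n.+1] it exceeds. *)
have Wn n : `|\int[P]_w (D w * W w)| <= n.+1%:R^-1 * \int[P]_w `|D w|.
  pose S (i : 'I_n.+1) := [set w | i.+1%:R / n.+1%:R <= W w].
  have mS i : measurable (S i) by exact/Gm/Gle.
  pose V w : R := \sum_(i < n.+1) \1_(S i) w.
  have mV : measurable_fun setT V.
    by apply: measurable_sum => i; apply: measurable_indic; exact: mS.
  have iDS i : P.-integrable setT (EFin \o (fun w => D w * \1_(S i) w)).
    apply: (integrable_mul_bounded (c := 1)) => //.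
    by move=> w; rewrite indicE ger0_norm//; case: (_ \in _).
  have DV : \int[P]_w (D w * V w) = 0.
    under eq_Rintegral do rewrite /V mulr_sumr.
    rewrite Rintegral_sum//= big1// => i _.
    by rewrite Rintegral_indicM//; exact/D0/Gle.
  have VW w : `|W w - n.+1%:R^-1 * V w| <= n.+1%:R^-1.
    have -> : W w - n.+1%:R^-1 * V w = n.+1%:R^-1 * (n.+1%:R * W w - V w).
      by rewrite mulrBr mulKf.
    rewrite normrM gtr0_norm ?invr_gt0// ler_piMr ?invr_ge0//.
    have -> : V w = \sum_(i < n.+1) (i.+1%:R <= n.+1%:R * W w)%R%:R.
      apply: eq_bigr => i _; rewrite indicE; congr (nat_of_bool _)%:R.
      rewrite [in RHS]mulrC -ler_pdivrMr//.
      by apply/idP/idP; rewrite inE.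
    apply: sum_indic_le; have /andP[W0 W1] := W01 w.
    by rewrite mulr_ge0//= -[leRHS]mulr1 ler_pM2l.
  have iV : P.-integrable setT (EFin \o (fun w => D w * (W w - n.+1%:R^-1 * V w))).
    apply: (integrable_mul_bounded iD _ VW).
    by apply: measurable_funB => //; apply: measurable_funM.
  have -> : \int[P]_w (D w * W w) = \int[P]_w (D w * (W w - n.+1%:R^-1 * V w)).
    have iDV : P.-integrable setT (EFin \o (fun w => D w * V w)).
      apply: eq_integrable (integrable_Rsum iDS) => //.
      by move=> w _ /=; rewrite /V mulr_sumr.
    have : \int[P]_w (D w * W w - n.+1%:R^-1 * (D w * V w)) = \int[P]_w (D w * W w).
      rewrite RintegralB//; last 2 first.
      - exact: integrable_mul_bounded iD mWT Wc.
      - exact: (@integrableZl _ _ _ P _ measurableT _ _ iDV).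
      by rewrite RintegralZl// DV mulr0 subr0.
    by move=> <-; apply: eq_Rintegral => w _; ring.
  apply: le_trans (le_normr_Rintegral _ iV) _ => //.
  rewrite -RintegralZl//; apply: le_Rintegral => //.
  - exact: integrable_norm iV.
  - exact: (@integrableZl _ _ _ P _ measurableT _ _ iT).
  - by move=> w _; rewrite normrM mulrC ler_wpM2r.
apply/eqP; rewrite -normr_eq0 eq_le normr_ge0 andbT.
rewrite leNgt; apply/negP => I0.
(* A nonzero integral would exceed [J / n.+1] for large [n], against [Wn]. *)
pose J := \int[P]_w `|D w|.
have J0 : 0 <= J by apply: Rintegral_ge0.
pose n := Num.truncn (J / `|\int[P]_w (D w * W w)|).
have : J / `|\int[P]_w (D w * W w)| < n.+1%:R by exact: truncnS_gt.
rewrite ltr_pdivrMr// -ltr_pdivrMl// => /lt_le_trans /(_ (Wn n)).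
by rewrite ltxx.
Qed.
Lemma Rintegral0_mul_set G D W c S : sigma_algebra setT G ->
  G `<=` measurable -> P.-integrable setT (EFin \o D) ->
  (forall S, G S -> \int[P]_(w in S) D w = 0) ->
  G.-measurable_fun W -> (forall w, `|W w| <= c) -> G S ->
  \int[P]_(w in S) (D w * W w) = 0.
Proof.
move=> sG Gm iD D0 mW Wc GS; have mS := Gm _ GS.
rewrite -Rintegral_indicM//.
have GE : <<s G>> = G by exact: sigma_algebra_id.
have m1 : G.-measurable_fun (\1_S : T -> R).
  by apply: (measurable_indic (T := g_sigma_algebraType G)); rewrite /measurable/= GE.
under eq_Rintegral do rewrite -mulrA.
apply: (Rintegral0_mul (c := c) sG Gm iD D0); first exact: measurable_funM.
move=> w; rewrite normrM -[leRHS]mulr1 ler_pM//.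
by rewrite indicE ger0_norm//; case: (_ \in _).
Qed.

(** The difference [D] is tested against its own sign [W], which is bounded and [G]-measurable:
    [D * W] is the absolute value of [D], so this absolute value has zero integral. *)
Lemma condexp_unique G V1 V2 : sigma_algebra setT G -> G `<=` measurable ->
  P.-integrable setT (EFin \o V1) -> P.-integrable setT (EFin \o V2) ->
  G.-measurable_fun V1 -> G.-measurable_fun V2 ->
  (forall S, G S -> \int[P]_(w in S) V1 w = \int[P]_(w in S) V2 w) ->
  {ae P, forall w, V1 w = V2 w}.
Proof.
move=> sG Gm i1 i2 m1 m2 V12; pose D w := V1 w - V2 w.
have iD : P.-integrable setT (EFin \o D).
  exact: (integrableB measurableT i1 i2).
have mD : G.-measurable_fun D by exact: measurable_funB.
have D0 S : G S -> \int[P]_(w in S) D w = 0.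
  move=> GS; rewrite RintegralB ?V12 ?subrr//; first exact: Gm.
    by apply: integrableS i1 => //; exact: Gm.
  by apply: integrableS i2 => //; exact: Gm.
pose W w : R := 2 * \1_[set w | 0 <= D w] w - 1.
have GE : <<s G>> = G by exact: sigma_algebra_id.
have mW : G.-measurable_fun W.
  apply: measurable_funB => //; apply: measurable_funM => //.
  apply: (measurable_indic (T := g_sigma_algebraType G)).
  rewrite (_ : [set w | 0 <= D w] = setT `&` (D @^-1` `[0, +oo[)).
    exact: mD.
  by apply/seteqP; split => w /=; rewrite in_itv/= andbT// => -[].
have W1 w : `|W w| <= 1.
  rewrite /W indicE; case: (_ \in _) => /=.
    by rewrite mulr1 ger0_norm; lra.
  by rewrite mulr0 sub0r normrN normr1.
have DW : \int[P]_w `|D w| = 0.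
  rewrite -[RHS](Rintegral0_mul sG Gm iD D0 mW W1).
  apply: eq_Rintegral => w _; rewrite /W indicE.
  have [D0w|D0w] := leP 0 (D w).
    by rewrite mem_set//= mulr1 ger0_norm//; ring.
  rewrite memNset/=; last by apply/negP; rewrite -ltNge.
  by rewrite ltr0_norm//; ring.
have : (\int[P]_w `|(D w)%:E| = 0)%E.
  transitivity (\int[P]_w (`|D w|)%:E)%E; first by [].
  rewrite -EFin_Rintegral//; first by rewrite DW.
  exact: integrable_norm iD.
have mDT : measurable_fun setT (EFin \o D) by case/integrableP : iD.
move/(ae_eq_integral_abs P measurableT mDT).
by apply: filterS => w /(_ I) []/eqP; rewrite subr_eq0 => /eqP.
Qed.

Lemma independent_g_sigma (I : finType) (C : I -> set_system T) :
  (forall i, C i `<=` measurable) -> (forall i, setI_closed (C i)) ->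
  (forall i, C i setT) ->
  (forall E, (forall i, C i (E i)) ->
    P (\bigcap_i E i) = (\prod_i P (E i))%E) ->
  forall E, (forall i, <<s C i >> (E i)) ->
    P (\bigcap_i E i) = (\prod_i P (E i))%E.
Proof.
move=> Cm CI CT CP.
have sCm i := g_sigma_algebra_sub (@Cm i).
(* The events are freed from the generating pi-systems one index at a time. *)
suff H (s : seq I) E : (forall i, i \in s -> <<s C i >> (E i)) ->
    (forall i, i \notin s -> C i (E i)) ->
    P (\bigcap_i E i) = (\prod_i P (E i))%E.
  by move=> E sE; apply: (H (index_enum I)) => // i; rewrite mem_index_enum.
elim: s E => [|i s ih] E sE nsE; first by apply: CP => i; exact: nsE.
have [is_|is_] := boolP (i \in s).
  apply: ih => j js; first by apply: sE; rewrite inE js orbT.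
  by apply: nsE; rewrite inE negb_or js andbT; apply: contraNneq js => ->.
have mE j : measurable (E j).
  have [js|js] := boolP (j \in i :: s); first by apply: (sCm j); exact: sE.
  by apply: (Cm j); exact: nsE.
pose F := \bigcap_(j in [set j | j != i]) E j.
have mF : measurable F.
  by apply: fin_bigcap_measurable => // ; exact: finite_finset.
pose c := (\prod_(j | j != i) P (E j))%E.
have cfin : c \is a fin_num.
  by rewrite /c; elim/big_ind : _ => // [x y|j _]; [exact: fin_numM|exact: fin_num_measure].
(* With the event of index [i] as a variable [S], the product formula says that [D] has zero
   integral over [S]. [Rintegral0_dynkin] therefore extends it from [C i] to the generated
   sigma-algebra; the total integral is the case [S = setT]. *)
pose D w : R := \1_F w - fine c.
have iF : P.-integrable setT (EFin \o (\1_F : T -> R)).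
  by apply: (integrable_bounded (c := 1)) => // w; rewrite indicE ger0_norm//; case: (_ \in _).
have ic : P.-integrable setT (EFin \o (cst (fine c) : T -> R)).
  exact: finite_measure_integrable_cst.
have iD : P.-integrable setT (EFin \o D) by exact: (integrableB measurableT iF ic).
have DE S : measurable S -> (\int[P]_(w in S) D w = 0) <-> P (S `&` F) = (P S * c)%E.
  move=> mS; rewrite RintegralB//; [|exact: integrableS iF|exact: integrableS ic].
  rewrite Rintegral_cst// /Rintegral integral_indic// setIC.
  rewrite -(fineK cfin) -(@fineK _ (P (S `&` F)))//; last first.
    exact/fin_num_measure/measurableI.
  rewrite -(@fineK _ (P S))//; last exact: fin_num_measure.
  rewrite /= -EFinM mulrC; split => [/eqP|[->]].
    by rewrite subr_eq0 => /eqP ->.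
  by rewrite subrr.
have bigE (E' : I -> set T) : (forall j, j != i -> E' j = E j) ->
    \bigcap_j E' j = E' i `&` F /\ (\prod_j P (E' j) = P (E' i) * c)%E.
  move=> E'E; split.
    apply/seteqP; split => [w h|w [hi h] j _]; last first.
      by have [->//|ji] := eqVneq j i; rewrite E'E//; exact: h.
    by split; [exact: h|move=> j /= ji; rewrite -E'E//; exact: h].
  by rewrite (bigD1 i)//=; congr (_ * _)%E; apply: eq_bigr => j /E'E ->.
have CD S : C i S -> \int[P]_(w in S) D w = 0.
  move=> CS; apply/DE; first exact: Cm CS.
  pose E' j := if j == i then S else E j.
  have [|e1 e2] := bigE E'; first by move=> j; rewrite /E' => /negbTE ->.
  have E'i : E' i = S by rewrite /E' eqxx.
  rewrite -E'i -e1 -e2; apply: ih => j js; rewrite /E'; case: eqVneq => [ji|ji].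
  - by rewrite -ji js in is_.
  - by apply: sE; rewrite inE js orbT.
  - by rewrite ji.
  - by apply: nsE; rewrite inE negb_or ji.
have [|-> ->] := bigE E; first by [].
apply/DE; first exact: mE.
apply: (Rintegral0_dynkin (@Cm i)) => //; first exact: CD.
by apply: sE; rewrite mem_head.
Qed.

(** For inclusions between sigma-algebras up to null events: the right-hand side being a
    sigma-algebra, generators suffice. [Q] will be the whole space for the dynamics and an atom of
    the edge past in [sigmaGA_atom]. *)
Lemma ae_sigma_algebra G (Q : set T) : sigma_algebra setT G ->
  sigma_algebra setT
    [set S | exists2 S', G S' & {ae P, forall w, Q w -> (S w <-> S' w)}].
Proof.
move=> [G0 GC GU]; split.
- by exists set0 => //; exact: aeW.
- move=> S [S' GS' SS']; exists (~` S'); first by rewrite -setTD; exact: GC.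
  apply: filterS SS' => w h /h {}h; rewrite setTD.
  by split => /= n /h.
- move=> F /(_ _)/cid2-/all_sig2[F' GF' FF'].
  exists (\bigcup_i F' i); first exact: GU.
  have /ae_foralln : forall n, {ae P, forall w, Q w -> (F n w <-> F' n w)} by [].
  apply: filterS => w h Qw.
  by split => -[n _ Fn]; exists n => //; apply/(h n Qw).
Qed.

End zero_integrals.

(** * Null sets under images, products and translations *)

Section almost_everywhere_image.
Context d1 d2 (T1 : measurableType d1) (T2 : measurableType d2) (R : realType).

Lemma ae_preimage (mu : {measure set T1 -> \bar R})
    (nu : {measure set T2 -> \bar R}) (f : T1 -> T2) (Q : T2 -> Prop) :
  measurable_fun setT f ->
  (forall N, measurable N -> nu N = 0%E -> mu (f @^-1` N) = 0%E) ->
  {ae nu, forall y, Q y} -> {ae mu, forall x, Q (f x)}.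
Proof.
move=> mf fN [N [mN N0 QN]]; exists (f @^-1` N); split => //.
- by rewrite -[X in measurable X]setTI; exact: mf.
- exact: fN.
- by move=> x /= nQ; apply: QN.
Qed.

End almost_everywhere_image.

Lemma measurable_preimage d1 d2 (T1 : measurableType d1)
    (T2 : measurableType d2) (f : T1 -> T2) (E : set T2) :
  measurable_fun setT f -> measurable E -> measurable (f @^-1` E).
Proof. by move=> mf mE; rewrite -[X in measurable X]setTI; exact: mf. Qed.

Section null_sets_product.
Context (R : realType) d1 d2 e1 e2 (X1 : measurableType d1)
  (X2 : measurableType d2) (Y1 : measurableType e1) (Y2 : measurableType e2).
Context (m1 : {measure set X1 -> \bar R})
  (m2 : {sigma_finite_measure set X2 -> \bar R})
  (n1 : {measure set Y1 -> \bar R})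
  (n2 : {sigma_finite_measure set Y2 -> \bar R}).

Lemma product_measure1_eq0 (N : set (Y1 * Y2)) : measurable N ->
  (n1 \x n2)%E N = 0%E <-> {ae n1, forall y, n2 (xsection N y) = 0%E}.
Proof.
move=> mN; have mf := measurable_fun_xsection n2 mN.
have := ae_eq_integral_abs n1 measurableT mf.
rewrite (eq_integral (n2 \o xsection N)); last first.
  by move=> y _ /=; rewrite gee0_abs.
move=> h; split => [/h|]; first by apply: filterS => y /(_ I).
by move=> a0; apply/h; apply: filterS a0 => y + _.
Qed.

(** The section of the preimage at [x] is the [f2]-preimage of the section at [f1 x], which is null
    for almost every [x]. This serves both translations of Lebesgue measure and the time marginals
    of two independent paths. *)
Lemma product_measure1_preimage0 (f1 : X1 -> Y1) (f2 : X2 -> Y2) :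
  measurable_fun setT f1 -> measurable_fun setT f2 ->
  (forall N, measurable N -> n1 N = 0%E -> m1 (f1 @^-1` N) = 0%E) ->
  (forall N, measurable N -> n2 N = 0%E -> m2 (f2 @^-1` N) = 0%E) ->
  forall N, measurable N -> (n1 \x n2)%E N = 0%E ->
    (m1 \x m2)%E ((fun x => (f1 x.1, f2 x.2)) @^-1` N) = 0%E.
Proof.
move=> mf1 mf2 f1N f2N N mN /(product_measure1_eq0 mN) N0.
have mg : measurable_fun setT (fun x : X1 * X2 => (f1 x.1, f2 x.2)).
  by apply: measurable_fun_pair; exact: measurableT_comp.
rewrite /product_measure1.
have mP := measurable_preimage mg mN.
have := ae_eq_integral_abs m1 measurableT (measurable_fun_xsection m2 mP).
rewrite (eq_integral (m2 \o xsection ((fun x => (f1 x.1, f2 x.2)) @^-1` N))); last first.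
  by move=> y _ /=; rewrite gee0_abs.
move=> [_]; apply.
apply: filterS (ae_preimage mf1 f1N N0) => x h _ /=.
rewrite -[RHS](f2N (xsection N (f1 x)))//; last exact: measurable_xsection.
Qed.

End null_sets_product.

Section translation.
Context (R : realType).

Lemma lebesgue_measure_translation (c : R) (A : set (measurableTypeR R)) :
  measurable A ->
  pushforward (@lebesgue_measure R) (+%R c : _ -> measurableTypeR R) A =
  lebesgue_measure A.
Proof.
move=> mA; apply/esym/lebesgue_measure_unique => //=.
  by have : measurable_fun [set: R] (fun x => c + x) by exact: measurable_funD.
move=> mc _ [[a b]] _ <-; rewrite /pushforward.
rewrite (_ : _ @^-1` _ = `](a - c), (b - c)]%classic); last first.
  by apply/seteqP; split => x/=; rewrite !in_itv/= ltrBlDl lerBrDl.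
rewrite !lebesgue_measure_itv/= !lte_fin ltrD2r.
by case: ifP => // _; rewrite -!EFinB; congr (_%:E); ring.
Qed.

(** Preservation of null sets, which is what absolute continuity after a noise step calls for,
    passes to products by [product_measure1_preimage0]; this carries the induction on [d]. *)
Lemma lebesgue_rV_translation d (c : 'rV[R]_d) (N : set 'rV[R]_d) :
  measurable N -> lebesgue_rV R d N = 0%E ->
  lebesgue_rV R d (+%R c @^-1` N) = 0%E.
Proof.
elim: d c N => [c N _ <-|d ih c N mN].
  congr (lebesgue_rV R 0 _); rewrite (_ : +%R c = id) ?preimage_id//.
  by apply/funext => v; rewrite (thinmx0 (c + v)) (thinmx0 v).
rewrite /= /lebesgue_cons /pushforward => N0.
pose c' := \row_i c 0 (lift ord0 i).
have mc : measurable_fun [set: R] (fun x => c 0 ord0 + x) by exact: measurable_funD.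
have mc' : measurable_fun setT (fun v : 'rV[R]_d => c' + v).
  apply: measurable_fun_matrix => i j; under eq_fun do rewrite mxE.
  by apply: measurable_funD => //; exact: measurable_entry.
have mN' : measurable (@rV_cons R d @^-1` N).
  exact: measurable_preimage (@measurable_rV_cons R d) mN.
have c0 (M : set R) : measurable M -> lebesgue_measure M = 0%E ->
    lebesgue_measure ((fun x => c 0 ord0 + x) @^-1` M) = 0%E.
  by move=> mM <-; exact: lebesgue_measure_translation.
have := product_measure1_preimage0 (m1 := @lebesgue_measure R)
  (n1 := @lebesgue_measure R) mc mc' c0 (ih c') mN' N0.
move=> <-; congr (_ _); apply/seteqP.
suff h (p : measurableTypeR R * 'rV[R]_d) :
    c + rV_cons p = rV_cons (c 0 ord0 + p.1 : measurableTypeR R, c' + p.2).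
  by split => p /=; rewrite h.
apply/rowP => i; rewrite !mxE; case: unliftP => [j|] -> /=; last by [].
by rewrite !mxE.
Qed.

End translation.

(** * Integrals of functions that need not be measurable *)

Section ae_integral.
Local Open Scope ereal_scope.
Context d (T : measurableType d) (R : realType) (mu : {measure set T -> \bar R}).
Import HBNNSimple.

(* Neither [f] nor [g] is assumed measurable: the integral of a nonnegative
   function is a supremum over the simple functions below it. *)
Lemma ge0_ae_eq_integral_nonmeasurable (f g : T -> \bar R) :
  (forall x, 0 <= f x) -> (forall x, 0 <= g x) ->
  {ae mu, forall x, f x = g x} -> \int[mu]_x f x = \int[mu]_x g x.
Proof.
suff H (f' g' : T -> \bar R) : (forall x, 0 <= f' x) -> (forall x, 0 <= g' x) ->
    {ae mu, forall x, f' x = g' x} -> \int[mu]_x f' x <= \int[mu]_x g' x.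
  move=> f0 g0 fg; apply/eqP; rewrite eq_le !H//.
  by apply: filterS fg => x ->.
move=> f0 g0 [N [mN N0 fgN]].
rewrite ge0_integralTE// ge0_integralTE//.
apply: ge_ereal_sup => _ /= [h hf <-].
(* Set to zero on the null set [N], the simple function lies below [g'] everywhere and keeps its
   integral. *)
pose h' : {nnsfun T >-> R} := proj_nnsfun h (measurableC mN).
apply: (@le_trans _ _ (sintegral mu h')); last first.
  apply: ereal_sup_ubound; exists h' => //= x.
  rewrite /h' /=; have [xN|xN] := pselect (N x).
    by rewrite mindicE memNset ?mulr0//=; apply.
  rewrite mindicE mem_set// mulr1 (_ : g' x = f' x)//.
  by apply: contrapT => fg; apply: xN; apply: fgN => /= /esym.
rewrite -!integralT_nnsfun le_eqVlt; apply/orP; left; apply/eqP.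
apply: ae_eq_integral => //; [exact/measurable_EFinP..|].
exists N; split => // x /= /not_implyP[_ hh']; apply: contrapT => xN; apply: hh'.
by rewrite /= mindicE mem_set// mulr1.
Qed.

Lemma ae_eq_integral_nonmeasurable (f g : T -> \bar R) :
  {ae mu, forall x, f x = g x} -> \int[mu]_x f x = \int[mu]_x g x.
Proof.
move=> fg; rewrite integralE [RHS]integralE; congr (_ - _);
  apply: ge0_ae_eq_integral_nonmeasurable => //.
- by apply: filterS fg => x; rewrite !funeposE => ->.
- by apply: filterS fg => x; rewrite !funenegE => ->.
Qed.

End ae_integral.

(** * Borel versions of the connection functions *)

Section borel_version.
Context (R : realType) (d : nat).
Local Notation Rd := 'rV[R]_d.

Definition grid n (v : Rd) : 'rV[int]_d :=
  \row_j Num.floor (n.+1%:R * v 0 j).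

Definition ungrid n (m : 'rV[int]_d) : Rd := \row_j ((m 0 j)%:~R / n.+1%:R).

Lemma measurable_grid n m : measurable [set v | grid n v = m].
Proof.
rewrite (_ : [set v | _] = \bigcap_(j in [set: 'I_d])
    ((fun v : Rd => n.+1%:R * v 0 j) @^-1` `[(m 0 j)%:~R, (m 0 j + 1)%:~R[)); last first.
  apply/seteqP; split => [v <- j _|v h] /=.
    by rewrite mxE in_itv/= -floor_eq.
  apply/rowP => j; rewrite mxE; apply/eqP; rewrite floor_eq.
  by have := h j I; rewrite /= in_itv.
apply: fin_bigcap_measurable; first exact: finite_finset.
move=> j _; apply: measurable_preimage; last exact: measurable_itv.
by apply: measurable_funM => //; exact: measurable_entry.
Qed.

Lemma cvg_grid (v : Rd) : ungrid n (grid n v) @[n --> \oo] --> v.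
Proof.
apply/cvg_ballP => e e0; near=> n; split => // i j.
rewrite /ball/= !mxE [i]ord1.
have : `|v 0 j - (Num.floor (n.+1%:R * v 0 j))%:~R / n.+1%:R| <= n.+1%:R^-1.
  have /andP[h1 h2] := real_floor_itv (num_real (n.+1%:R * v 0 j)).
  set k := (Num.floor _)%:~R in h1 *.
  have -> : v 0 j - k / n.+1%:R = (n.+1%:R * v 0 j - k) / n.+1%:R.
    by rewrite mulrBl [n.+1%:R * _]mulrC mulfK.
  rewrite normrM [X in _ * X]gtr0_norm ?invr_gt0// ler_piMl ?invr_ge0//.
  move: h2; rewrite intrD => h2.
  by rewrite ger0_norm; lra.
move=> /le_lt_trans; apply.
near: n; exact: near_infty_natSinv_lt (PosNum e0).
Unshelve. all: by end_near. Qed.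

(* The version is the upper limit of [f] along roundings to finer and finer
   grids; a rounding takes countably many values, so that no measurability of
   [f] is needed. *)
Lemma borel_version (f : Rd * Rd -> R) : (forall z, 0 <= f z <= 1) ->
  exists2 g : Rd * Rd -> R, measurable_fun setT g &
    (forall z, 0 <= g z <= 1) /\ (forall z, {for z, continuous f} -> f z = g z).
Proof.
move=> f01.
pose h n (z : Rd * Rd) := f (ungrid n (grid n z.1), ungrid n (grid n z.2)).
have mh n : measurable_fun setT (h n).
  move=> _ Y mY; rewrite setTI.
  pose F (m : 'rV[int]_d * 'rV[int]_d) : set (Rd * Rd) :=
    [set z | Y (f (ungrid n m.1, ungrid n m.2))] `&`
    ([set v | grid n v = m.1] `*` [set v | grid n v = m.2]).
  rewrite (_ : h n @^-1` Y = \bigcup_m F m); last first.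
    apply/seteqP; split => [z hz|z [m _ [Ym [/= h1 h2]]]].
      by exists (grid n z.1, grid n z.2).
    by rewrite /h/= h1 h2.
  apply: countable_bigcupT_measurable; first exact: countableP.
  move=> m; apply: measurableI.
    have [Ym|Ym] := pselect (Y (f (ungrid n m.1, ungrid n m.2))).
      by rewrite (_ : [set z : Rd * Rd | _] = setT)//; apply/seteqP; split.
    by rewrite (_ : [set z : Rd * Rd | _] = set0)//; apply/seteqP; split => // z /Ym.
  by apply: measurableX; exact: measurable_grid.
(* The truncation gives the bounds on [g] at every point, without an estimate of the upper limit. *)
pose g z := Num.max 0 (Num.min (limn_sup (h ^~ z)) 1).
exists g.
  apply: (@measurable_maxr _ _ _ _ (cst 0) (fun z => Num.min (limn_sup (h ^~ z)) 1)) => //.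
  apply: (@measurable_minr _ _ _ _ (fun z => limn_sup (h ^~ z)) (cst 1)) => //.
  apply: measurable_fun_limn_sup => // z _.
  - by exists 1 => _ [n _ <-]; case/andP: (f01 (ungrid n (grid n z.1), ungrid n (grid n z.2))).
  - by exists 0 => _ [n _ <-]; case/andP: (f01 (ungrid n (grid n z.1), ungrid n (grid n z.2))).
split=> [z|[x y] cz]; first by rewrite /g le_max lexx/= ge_max ler01/= ge_min lexx orbT.
have hz : h ^~ (x, y) @ \oo --> f (x, y).
  apply: (cvg_comp (fun n => (ungrid n (grid n x), ungrid n (grid n y))) f); last exact: cz.
  exact: (cvg_pair (@cvg_grid x) (@cvg_grid y)).
have [_ e] := cvg_limn_inf_sup hz.
rewrite /g e; have /andP[f0 f1] := f01 (x, y).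
by rewrite min_l// max_r.
Qed.

Lemma connection_borel (f : Rd -> Rd -> R) : connection_function f ->
  exists g : Rd -> Rd -> R,
    [/\ measurable_fun setT (fun z : Rd * Rd => g z.1 z.2),
        forall x y, 0 <= g x y <= 1
      & {ae (lebesgue_rV R d \x lebesgue_rV R d)%E,
          forall z, f z.1 z.2 = g z.1 z.2}].
Proof.
move=> [f01 _ fc].
have [|g mg [g01 fg]] := @borel_version (fun z => f z.1 z.2).
  by move=> z; exact: f01.
exists (fun x y => g (x, y)); split.
- by rewrite (_ : (fun z => _) = g)//; apply/funext => -[].
- by move=> x y; exact: g01.
- by apply: filterS fc => z /fg ->; case: z.
Qed.

End borel_version.

Lemma ae_product d1 d2 (T1 : measurableType d1) (T2 : measurableType d2)
    (R : realType) (m1 : {measure set T1 -> \bar R})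
    (m2 : {sigma_finite_measure set T2 -> \bar R}) (Q : T1 * T2 -> Prop) :
  {ae (m1 \x m2)%E, forall z, Q z} ->
  {ae m1, forall x, {ae m2, forall y, Q (x, y)}}.
Proof.
move=> [N [mN N0 QN]].
have /(product_measure1_eq0 m1 m2 mN) := N0; apply: filterS => x Nx.
exists (xsection N x); split => //; first exact: measurable_xsection.
by move=> y /= nQ; rewrite /xsection/= inE; apply: QN.
Qed.

(** * Measurability of the mean-field averages and their Borel replacement *)

Section measurable_parameter_integral.
Context d1 d2 (T1 : measurableType d1) (T2 : measurableType d2) (R : realType).

(** Tonelli is applied to the positive and the negative part separately, so the integral may fail to
    exist for some [x]: the averages are well defined along almost every path only. *)
Lemma measurable_fun_Rintegral (mu : probability T2 R) (f : T1 * T2 -> R) :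
  measurable_fun setT f -> measurable_fun setT (fun x => \int[mu]_y f (x, y)).
Proof.
move=> mf; have mf' : measurable_fun setT (EFin \o f) by exact/measurable_EFinP.
rewrite (_ : (fun x => _) = fine \o (fun x => \int[mu]_y (EFin \o f)^\+ (x, y) -
    \int[mu]_y (EFin \o f)^\- (x, y))%E); last first.
  apply/funext => x; rewrite /Rintegral/= integralE.
  by congr (fine (_ - _)%E); apply: eq_integral => y _; rewrite ?funeposE ?funenegE.
apply: measurableT_comp; first exact: fine_measurable.
apply: emeasurable_funB.
  apply: (measurable_fun_fubini_tonelli_F (m2 := mu)) => //.
  exact: measurable_funepos.
apply: (measurable_fun_fubini_tonelli_F (m2 := mu)) => //.
exact: measurable_funeneg.
Qed.

Lemma measurable_funV (f : T1 -> R) :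
  measurable_fun setT f -> measurable_fun setT (fun x => (f x)^-1).
Proof.
(* The inverse of a real is the real times the square of the inverse of its absolute value, and real
   powers are measurable. At 0 both sides are 0. *)
move=> mf; rewrite (_ : (fun x => _) = fun x => f x * (`|f x| `^ (-1)) ^+ 2).
  apply: measurable_funM => //; apply: measurable_funX.
  apply: (measurableT_comp (measurable_powR _)).
  exact: measurableT_comp.
apply/funext => x; have [->|fx] := eqVneq (f x) 0.
  by rewrite invr0 mul0r.
rewrite powR_inv1// exprVn real_normK ?num_real// expr2 invfM mulrA.
by rewrite mulfV// mul1r.
Qed.

End measurable_parameter_integral.

Lemma measurable_tuple_nth d (U : measurableType d) (x0 : U) s r : (r <= s)%N ->
  measurable_fun setT (fun x : s.+1.-tuple U => nth x0 x r).
Proof.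
move=> rs; rewrite (_ : (fun x => _) = (fun x => tnth x (Ordinal (rs : (r < s.+1)%N)))).
  exact: measurable_tnth.
by apply/funext => x; rewrite (tnth_nth x0).
Qed.

Section measurable_trajectories.
Context (R : realType) (d : nat).
Local Notation Rd := 'rV[R]_d.

Context (B : bool -> Rd -> Rd -> R) (B0 : Rd -> Rd -> R).

Lemma Btraj01 s z1 z2 : (forall a x y, 0 <= B a x y <= 1) ->
  (forall x y, 0 <= B0 x y <= 1) -> 0 <= Btraj B B0 s z1 z2 <= 1.
Proof.
move=> B01 B001; elim: s => [|s /andP[p0 p1]] //=; rewrite /Bhat.
have /andP[t0 t1] := B01 true z1`_s.+1 z2`_s.+1.
have /andP[f0 f1] := B01 false z1`_s.+1 z2`_s.+1.
by apply/andP; split; nra.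
Qed.

Lemma measurable_Btraj s r : (r <= s)%N ->
  (forall a, measurable_fun setT (fun z : Rd * Rd => B a z.1 z.2)) ->
  measurable_fun setT (fun z : Rd * Rd => B0 z.1 z.2) ->
  measurable_fun setT
    (fun q : s.+1.-tuple Rd * s.+1.-tuple Rd => Btraj B B0 r q.1 q.2).
Proof.
move=> rs mB mB0.
have mpair r' : (r' <= s)%N -> measurable_fun setT
    (fun q : s.+1.-tuple Rd * s.+1.-tuple Rd => (q.1`_r', q.2`_r')).
  move=> r's; apply: measurable_fun_pair => /=.
    exact: (measurableT_comp (measurable_tuple_nth _ r's)).
  exact: (measurableT_comp (measurable_tuple_nth _ r's)).
elim: r rs => [_|r ih rs]; first exact: (measurableT_comp mB0 (mpair 0 _)).
have mr := ih (ltnW rs).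
apply: measurable_funD; apply: measurable_funM => //.
- exact: (measurableT_comp (mB true) (mpair _ rs)).
- exact: measurable_funB.
- exact: (measurableT_comp (mB false) (mpair _ rs)).
Qed.

Lemma measurable_mean_field_average s (mu : probability (s.+1.-tuple Rd) R) :
  (forall a, measurable_fun setT (fun z : Rd * Rd => B a z.1 z.2)) ->
  measurable_fun setT (fun z : Rd * Rd => B0 z.1 z.2) ->
  measurable_fun setT (mean_field_average B B0 mu).
Proof.
move=> mB mB0; have mBs := measurable_Btraj (leqnn s) mB mB0.
apply: measurable_fun_matrix => i j.
under eq_fun do rewrite mxE.
have mf : measurable_fun setT (fun q : s.+1.-tuple Rd * s.+1.-tuple Rd =>
    q.2`_s 0 j * Btraj B B0 s q.1 q.2).
  apply: measurable_funM => //.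
  apply: (measurableT_comp (measurable_entry 0 j)).
  exact: (measurableT_comp (measurable_tuple_nth _ (leqnn s))).
apply: measurable_funM; first exact: (measurable_fun_Rintegral mu mf).
by apply: measurable_funV; exact: (measurable_fun_Rintegral mu mBs).
Qed.

Context (B' : bool -> Rd -> Rd -> R) (B0' : Rd -> Rd -> R).
Hypothesis BB' : forall a, {ae (lebesgue_rV R d \x lebesgue_rV R d)%E,
  forall z, B a z.1 z.2 = B' a z.1 z.2}.
Hypothesis BB0' : {ae (lebesgue_rV R d \x lebesgue_rV R d)%E,
  forall z, B0 z.1 z.2 = B0' z.1 z.2}.

Lemma eq_Btraj r z1 z2 :
  (forall u a, (u <= r)%N -> B a z1`_u z2`_u = B' a z1`_u z2`_u) ->
  B0 z1`_0 z2`_0 = B0' z1`_0 z2`_0 ->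
  Btraj B B0 r z1 z2 = Btraj B' B0' r z1 z2.
Proof.
elim: r => [//|r ih] h h0 /=; rewrite /Bhat !h// ih// => u a ur.
by apply: h; exact: leqW.
Qed.

Section fixed_time.
Context s (mu : probability (s.+1.-tuple Rd) R).
Hypothesis mu_ac : forall r, (r <= s)%N -> forall N : set Rd, measurable N ->
  lebesgue_rV R d N = 0%E -> mu ((fun x : s.+1.-tuple Rd => x`_r) @^-1` N) = 0%E.

(** Under the product the two positions at time [r] are independent with absolutely continuous laws,
    so the pair avoids Lebesgue null sets. A path paired with itself stays on the diagonal, which
    may be such a set; hence the restriction to distinct particles later. *)
Lemma ae_connection_tuple r (Q : Rd * Rd -> Prop) : (r <= s)%N ->
  {ae (lebesgue_rV R d \x lebesgue_rV R d)%E, forall z, Q z} ->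
  {ae (mu \x mu)%E, forall q : s.+1.-tuple Rd * s.+1.-tuple Rd, Q (q.1`_r, q.2`_r)}.
Proof.
move=> rs; have mr := measurable_tuple_nth (0 : Rd) rs.
apply: (ae_preimage (f := fun q : s.+1.-tuple Rd * s.+1.-tuple Rd => (q.1`_r, q.2`_r))).
  apply: measurable_fun_pair => /=; first exact: (measurableT_comp mr).
  exact: (measurableT_comp mr).
exact: (product_measure1_preimage0 (m1 := mu) (m2 := mu)
  (n1 := lebesgue_rV R d) (n2 := lebesgue_rV R d) mr mr (mu_ac rs) (mu_ac rs)).
Qed.

Lemma ae_eq_connection :
  {ae (mu \x mu)%E, forall q : s.+1.-tuple Rd * s.+1.-tuple Rd, (forall u a, (u <= s)%N ->
      B a q.1`_u q.2`_u = B' a q.1`_u q.2`_u) /\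
    B0 q.1`_0 q.2`_0 = B0' q.1`_0 q.2`_0}.
Proof.
have h a : {ae (mu \x mu)%E, forall q : s.+1.-tuple Rd * s.+1.-tuple Rd,
    forall u, (u <= s)%N ->
      B a q.1`_u q.2`_u = B' a q.1`_u q.2`_u}.
  apply: ae_foralln => u; have [us|us] := boolP (u <= s)%N; last exact: aeW.
  by apply: filterS (ae_connection_tuple us (BB' a)) => q + _.
have h0 := ae_connection_tuple (leq0n s) BB0'.
apply: filterS3 (h true) (h false) h0 => q ht hf h0q; split => // u [] us.
  exact: ht.
exact: hf.
Qed.

Lemma ae_eq_Btraj : {ae (mu \x mu)%E,
  forall q : s.+1.-tuple Rd * s.+1.-tuple Rd, forall r, (r <= s)%N ->
  Btraj B B0 r q.1 q.2 = Btraj B' B0' r q.1 q.2}.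
Proof.
apply: filterS ae_eq_connection => q [h h0] r rs; apply: eq_Btraj => // u a ur.
exact/h/(leq_trans ur).
Qed.

(** By [ae_product], for almost every [x] the two kernels agree at almost every [z]. The integrands
    built from [B] and [B0] need not be measurable, so their integrals are compared by
    [ae_eq_integral_nonmeasurable]. *)
Lemma ae_eq_mean_field_average : {ae mu, forall x,
  mean_field_average B B0 mu x = mean_field_average B' B0' mu x}.
Proof.
apply: filterS (ae_product ae_eq_Btraj) => x h.
apply/rowP => l; rewrite !mxE; congr (_ / _).
  congr fine; apply: ae_eq_integral_nonmeasurable.
  by apply: filterS h => y /= ->.
congr fine; apply: ae_eq_integral_nonmeasurable.
by apply: filterS h => y /= ->.
Qed.

End fixed_time.
End measurable_trajectories.

(** * Independence of pairs *)

Section independent_pairs.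
Context d e1 e2 (T : measurableType d) (U : measurableType e1)
  (V : measurableType e2) (R : realType) (P : probability T R) (J : finType).
Context (X : J -> T -> U) (Y : J -> T -> V) (mu : probability U R)
  (nu : probability V R).
Hypothesis mX : forall i, measurable_fun setT (X i).
Hypothesis mY : forall i, measurable_fun setT (Y i).
Hypothesis XY : forall (C : J -> set U) (D : J -> set V),
  (forall i, measurable (C i)) -> (forall i, measurable (D i)) ->
  P (\bigcap_i (X i @^-1` C i `&` Y i @^-1` D i)) = (\prod_i (mu (C i) * nu (D i)))%E.

Lemma rectangle_law i (C : set U) (D : set V) : measurable C -> measurable D ->
  P (X i @^-1` C `&` Y i @^-1` D) = (mu C * nu D)%E.
Proof.
move=> mC mD.
pose C' j := if j == i then C else setT.
pose D' j := if j == i then D else setT.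
have /= := @XY C' D'.
rewrite (bigD1 i)//= big1 ?mule1; last first.
  by move=> j ji; rewrite /C' /D' (negbTE ji) !probability_setT mule1.
rewrite {3}/C' {3}/D' eqxx => <-.
- congr (P _); apply/seteqP; split => [w [Cw Dw] j _|w /(_ i I)].
    by rewrite /C' /D'; case: eqVneq => [->|].
  by rewrite /C' /D' eqxx.
- by move=> j; rewrite /C'; case: ifP.
- by move=> j; rewrite /D'; case: ifP.
Qed.

Lemma pair_law i (S : set (U * V)) : measurable S ->
  P ((fun w => (X i w, Y i w)) @^-1` S) = (mu \x nu)%E S.
Proof.
move=> mS; have mp : measurable_fun setT (fun w => (X i w, Y i w)).
  exact: measurable_fun_pair.
pose p : {mfun T >-> (U * V)%type} := mfun_Sub (mem_set mp).
rewrite [RHS](product_measure_unique (m' := distribution P p))// => C D mC mD.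
by rewrite -(rectangle_law i mC mD); congr (P _).
Qed.

(** Rectangles are a pi-system generating the sigma-algebra of each pair, and [XY] is the product
    formula on them, so [independent_g_sigma] applies. *)
Lemma independent_pairs (S : J -> set (U * V)) :
  (forall i, measurable (S i)) ->
  P (\bigcap_i ((fun w => (X i w, Y i w)) @^-1` S i)) =
  (\prod_i P ((fun w => (X i w, Y i w)) @^-1` S i))%E.
Proof.
move=> mS.
pose C i : set_system T := [set A | exists2 CD : set U * set V,
  measurable CD.1 /\ measurable CD.2 & A = X i @^-1` CD.1 `&` Y i @^-1` CD.2].
apply: (@independent_g_sigma _ _ _ P _ C).
- move=> i _ [[A B] [/= mA mB] ->].
  by apply: measurableI; exact: measurable_preimage.
- move=> i _ _ [[A B] [/= mA mB] ->] [[A' B'] [/= mA' mB'] ->].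
  exists (A `&` A', B `&` B') => /=; first by split; exact: measurableI.
  by rewrite !preimage_setI setIACA.
- by move=> i; exists (setT, setT) => //=; rewrite !preimage_setT setIT.
- move=> E /(_ _)/cid2-/all_sig2[CD mCD ECD].
  have mCD1 i := (mCD i).1; have mCD2 i := (mCD i).2.
  rewrite (eq_bigcapr (fun i _ => ECD i)) (XY mCD1 mCD2).
  by apply: eq_bigr => i _; rewrite ECD rectangle_law.
- move=> i.
  have mp : (C i).-measurable_fun (fun w => (X i w, Y i w)).
    apply: measurable_fun_pair.
      move=> _ E mE; apply: sub_sigma_algebra; exists (E, setT) => //=.
      by rewrite preimage_setT setTI setIT.
    by move=> _ E mE; apply: sub_sigma_algebra; exists (setT, E) => //=.
  by have := mp measurableT (S i) (mS i); rewrite setTI.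
Qed.

End independent_pairs.

(** * Trajectories, sub-sigma-algebras, versions of conditional expectations *)

Lemma ae_eq_measure d (T : measurableType d) (R : realType)
    (P : {measure set T -> \bar R}) (S S' : set T) :
  measurable S -> measurable S' -> {ae P, forall w, S w <-> S' w} -> P S = P S'.
Proof.
move=> mS mS' SS'.
rewrite -(setIT S) -(setIT S') -!integral_indic//.
apply: ae_eq_integral => //; [exact/measurable_EFinP/measurable_indic..|].
apply: filterS SS' => w h _; rewrite !indicE; congr (_%:R%:E).
by congr nat_of_bool; apply/idP/idP; rewrite !inE => /h.
Qed.

Lemma nth_traj d d' (T : measurableType d) (U : measurableType d') s
    (X : nat -> {mfun T >-> U}) (w : T) (x0 : U) r : (r <= s)%N ->
  nth x0 (traj s X w) r = X r w.
Proof.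
move=> rs; have rs' : (r < s.+1)%N by [].
by rewrite -[r]/(val (Ordinal rs')) -tnth_nth tnth_mktuple.
Qed.

Lemma g_sigma_algebra_bigcap (T : pointedType) (G : set_system T) (I : finType)
    (D : set I) (F : I -> set T) : (forall i, D i -> <<s G >> (F i)) ->
  <<s G >> (\bigcap_(i in D) F i).
Proof.
move=> GF; apply: (@fin_bigcap_measurable _ (g_sigma_algebraType G)) => //.
Qed.

Section sub_sigma_algebras.
Context d (T : measurableType d).
Implicit Types G H : set_system T.

Lemma measurable_fun_sigmaP d' (U : measurableType d') G (f : T -> U) :
  sigma_algebra setT G ->
  G.-measurable_fun f <-> g_sigma_algebra_preimage f `<=` G.
Proof.
move=> sG; have GE : <<s G>> = G by exact: sigma_algebra_id.
split => [mf _ [E mE <-]|fG _ E mE].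
  by rewrite -GE; exact: mf.
by rewrite /measurable/= GE; apply: fG; exists E.
Qed.

Lemma sigma_algebra_sigma_rvs d' (U : measurableType d') (J : Type)
  (X : J -> T -> U) : sigma_algebra setT (sigma_rvs X).
Proof. exact: smallest_sigma_algebra. Qed.

Lemma sigma_algebra_sigma_join G H : sigma_algebra setT (sigma_join G H).
Proof. exact: smallest_sigma_algebra. Qed.

Lemma sigma_rvs_measurable d' (U : measurableType d') (J : Type)
  (X : J -> T -> U) j : (sigma_rvs X).-measurable_fun (X j).
Proof.
apply/measurable_fun_sigmaP; first exact: sigma_algebra_sigma_rvs.
by move=> E XE; apply: sub_sigma_algebra; exists j.
Qed.

Lemma sub_sigma_rvs d' (U : measurableType d') (J : Type) (X : J -> T -> U) G :
  sigma_algebra setT G -> (forall j, G.-measurable_fun (X j)) ->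
  sigma_rvs X `<=` G.
Proof.
move=> sG XG; apply: smallest_sub => // E [j _]; move: E.
exact/measurable_fun_sigmaP.
Qed.

Lemma sub_sigma_join F H G : sigma_algebra setT G -> F `<=` G -> H `<=` G ->
  sigma_join F H `<=` G.
Proof. by move=> sG FG HG; apply: smallest_sub => // E [/FG|/HG]. Qed.

Lemma sigma_joinl F H : F `<=` sigma_join F H.
Proof. by move=> E FE; apply: sub_sigma_algebra; left. Qed.

Lemma sigma_joinr F H : H `<=` sigma_join F H.
Proof. by move=> E FE; apply: sub_sigma_algebra; right. Qed.

Lemma sub_measurable_fun d' (U : measurableType d') G H (f : T -> U) :
  sigma_algebra setT G -> sigma_algebra setT H -> G `<=` H ->
  G.-measurable_fun f -> H.-measurable_fun f.
Proof.
move=> sG sH GH /(measurable_fun_sigmaP _ sG) fG.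
by apply/(measurable_fun_sigmaP _ sH); exact: subset_trans GH.
Qed.

Lemma measurable_fun_traj d' (U : measurableType d') G s
    (X : nat -> {mfun T >-> U}) :
  G.-measurable_fun (traj s X) <-> (forall r, (r <= s)%N -> G.-measurable_fun (X r)).
Proof.
split=> [h r rs|h].
  have rs' : (r < s.+1)%N by [].
  have := measurableT_comp (measurable_tnth (Ordinal rs')) h.
  by apply: eq_measurable_fun => w _ /=; rewrite tnth_mktuple.
apply/measurable_fun_tnthP => i.
have := h i (ltn_ord i).
by apply: eq_measurable_fun => w _ /=; rewrite tnth_mktuple.
Qed.

Lemma measurable_from_bool d' (V : measurableType d') (f : bool -> V) : measurable_fun setT f.
Proof. by []. Qed.

End sub_sigma_algebras.

Arguments sigma_rvs_measurable {d T d' U J} X j.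
Arguments measurable_from_bool {d' V} f.

Lemma ae_eq_Rintegral_set d (T : measurableType d) (R : realType)
    (P : probability T R) (D : T -> R) (S S' : set T) :
  P.-integrable setT (EFin \o D) -> measurable S -> measurable S' ->
  {ae P, forall w, S w <-> S' w} ->
  \int[P]_(w in S) D w = \int[P]_(w in S') D w.
Proof.
move=> iD mS mS' SS'; rewrite -(Rintegral_indicM P D mS) -(Rintegral_indicM P D mS').
have mD : measurable_fun setT D.
  by apply/measurable_EFinP; case/integrableP : iD.
apply: ae_eq_Rintegral.
- by apply: measurable_funM => //; exact: measurable_indic.
- by apply: measurable_funM => //; exact: measurable_indic.
- apply: filterS SS' => w h; congr (_ * _); rewrite !indicE; congr (_%:R).
  by congr nat_of_bool; apply/idP/idP; rewrite !inE => /h.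
Qed.

Section condexp_eq.
Context d (T : measurableType d) (R : realType) (P : probability T R).
Implicit Types (X Y V : T -> R) (G : set_system T).

Lemma condexp_eqE G X Y : sigma_algebra setT G -> condexp_eq P G X Y ->
  exists V, [/\ G.-measurable_fun V, P.-integrable setT (EFin \o V),
    forall S, G S -> \int[P]_(w in S) V w = \int[P]_(w in S) X w
  & {ae P, forall w, Y w = V w}].
Proof.
move=> sG [V [mV iV VX YV]]; exists V; split => //.
  exact/measurable_fun_sigmaP.
by move=> S GS; rewrite /Rintegral VX.
Qed.

Lemma condexp_eqI G X Y V : sigma_algebra setT G -> G `<=` measurable ->
  P.-integrable setT (EFin \o X) -> P.-integrable setT (EFin \o V) ->
  G.-measurable_fun V ->
  (forall S, G S -> \int[P]_(w in S) V w = \int[P]_(w in S) X w) ->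
  {ae P, forall w, Y w = V w} -> condexp_eq P G X Y.
Proof.
move=> sG Gm iX iV mV VX YV; exists V; split => //.
  exact/measurable_fun_sigmaP.
by move=> S GS; have mS := Gm _ GS; rewrite -!EFin_Rintegral// VX.
Qed.

End condexp_eq.

Lemma Btraj_congr (R : realType) d (B : bool -> 'rV[R]_d -> 'rV[R]_d -> R) B0 s
    (z1 z2 y1 y2 : seq 'rV[R]_d) : (forall r, (r <= s)%N -> z1`_r = y1`_r) ->
  (forall r, (r <= s)%N -> z2`_r = y2`_r) ->
  Btraj B B0 s z1 z2 = Btraj B B0 s y1 y2.
Proof.
elim: s => [|s ih] h1 h2 /=; first by rewrite h1// h2.
by rewrite h1// h2// ih// => r rs; [rewrite h1|rewrite h2]; rewrite // leqW.
Qed.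

Section bernoulli_event.
Context (R : realType).

(** The probability of [E] under the Bernoulli law with parameter [p]. It is affine in [p] and
    becomes the indicator of [E] when [p] is a state, so an identity for the mean of an edge yields
    one for each event of the edge. *)
Definition bernoulli_event (E : set bool) (p : R) : R :=
  p * \1_E true + (1 - p) * \1_E false.

Lemma bernoulli_event01 E p : 0 <= p <= 1 -> 0 <= bernoulli_event E p <= 1.
Proof.
move=> /andP[p0 p1]; rewrite /bernoulli_event !indicE.
by case: (true \in E); case: (false \in E) => /=; apply/andP; split; lra.
Qed.

Lemma bernoulli_event_nat E (b : bool) : bernoulli_event E b%:R = \1_E b.
Proof. by rewrite /bernoulli_event; case: b => /=; ring. Qed.

Lemma bernoulli_eventB E p q : bernoulli_event E p - bernoulli_event E q =
  (\1_E true - \1_E false) * (p - q).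
Proof. by rewrite /bernoulli_event; ring. Qed.

Lemma measurable_bernoulli_event d (T : measurableType d) E (f : T -> R) :
  measurable_fun setT f -> measurable_fun setT (fun w => bernoulli_event E (f w)).
Proof.
move=> mf; apply: measurable_funD; apply: measurable_funM => //.
exact: measurable_funB.
Qed.

End bernoulli_event.

Lemma indic_preimage (T U : Type) (R : pzRingType) (f : T -> U) (E : set U) w :
  \1_(f @^-1` E) w = \1_E (f w) :> R.
Proof. by rewrite !indicE; congr (_%:R); congr nat_of_bool; apply/idP/idP; rewrite !inE. Qed.

Lemma prod01 (R : realDomainType) (J : finType) (p : pred J) (f : J -> R) :
  (forall j, p j -> 0 <= f j <= 1) -> 0 <= \prod_(j | p j) f j <= 1.
Proof.
move=> f01; elim/big_ind : _ => [|x y /andP[x0 x1] /andP[y0 y1]|//].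
  by rewrite ler01 lexx.
by rewrite mulr_ge0// mulr_ile1.
Qed.

Lemma measurable_bigprod d (T : measurableType d) (R : realType) (J : finType)
    (p : pred J) (f : J -> T -> R) :
  (forall j, p j -> measurable_fun setT (f j)) ->
  measurable_fun setT (fun w => \prod_(j | p j) f j w).
Proof.
move=> mf; under eq_fun do rewrite -big_filter.
by apply: measurable_prod => j; rewrite mem_filter => /andP[/mf].
Qed.

(** * The mean-field process *)

Section process.
Context (R : realType) (d : nat) (gamma : R).
Local Notation Rd := 'rV[R]_d.
Context (B : bool -> Rd -> Rd -> R) (B0 : Rd -> Rd -> R)
  (mu0 nu : probability Rd R)
  (mu0_ac : mu0 `<< lebesgue_rV R d) (nu_ac : nu `<< lebesgue_rV R d)
  (k : nat) (t : nat)
  (disp : measure_display) (T : measurableType disp) (P : probability T R)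
  (Z : 'I_k -> nat -> {RV P >-> Rd})
  (A : 'I_k -> 'I_k -> nat -> {RV P >-> bool})
  (xi : 'I_k -> nat -> {RV P >-> Rd}) (i1 : 'I_k)
  (process : mean_field_process gamma B B0 Z A t i1 mu0 nu xi).
Context (B' : bool -> Rd -> Rd -> R) (B0' : Rd -> Rd -> R).
Hypothesis mB' : forall a, measurable_fun setT (fun z : Rd * Rd => B' a z.1 z.2).
Hypothesis mB0' : measurable_fun setT (fun z : Rd * Rd => B0' z.1 z.2).
Hypothesis BB' : forall a, {ae (lebesgue_rV R d \x lebesgue_rV R d)%E,
  forall z, B a z.1 z.2 = B' a z.1 z.2}.
Hypothesis BB0' : {ae (lebesgue_rV R d \x lebesgue_rV R d)%E,
  forall z, B0 z.1 z.2 = B0' z.1 z.2}.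
Hypothesis B'01 : forall a x y, 0 <= B' a x y <= 1.
Hypothesis B0'01 : forall x y, 0 <= B0' x y <= 1.

(** * Paths are i.i.d. with absolutely continuous positions *)

Definition path_law s : probability (s.+1.-tuple Rd) R :=
  distribution P (traj s (Z i1)).

(** Absolute continuity belongs to the induction: at time [s] it allows the average to be replaced
    by a Borel function of the path, from which the law at time [s.+1] is then computed. *)
Definition iid_until s := [/\ forall i, has_law P (traj s (Z i)) (path_law s),
  mutually_independent P (fun i => traj s (Z i))
  & forall r, (r <= s)%N -> forall N, measurable N -> lebesgue_rV R d N = 0%E ->
    P (Z i1 r @^-1` N) = 0%E].

Definition drift s (x : s.+1.-tuple Rd) : Rd :=
  (1 - gamma) *: x`_s + gamma *: mean_field_average B' B0' (path_law s) x.

Lemma measurable_drift s : measurable_fun setT (@drift s).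
Proof.
have mm := measurable_mean_field_average (path_law s) mB' mB0'.
apply: measurable_fun_matrix => i j.
rewrite (_ : (fun x => _) = fun x : s.+1.-tuple Rd => (1 - gamma) * x`_s i j +
    gamma * mean_field_average B' B0' (path_law s) x i j); last first.
  by apply/funext => x; rewrite /drift !mxE.
apply: measurable_funD; apply: measurable_funM => //.
  apply: (measurableT_comp (measurable_entry i j)).
  exact: (measurable_tuple_nth _ (leqnn s)).
exact: (measurableT_comp (measurable_entry i j) mm).
Qed.

Lemma path_law_ac s : iid_until s -> forall r, (r <= s)%N ->
  forall N : set Rd, measurable N -> lebesgue_rV R d N = 0%E ->
  path_law s ((fun x : s.+1.-tuple Rd => x`_r) @^-1` N) = 0%E.
Proof.
move=> [_ _ ac] r rs N mN N0; rewrite -(ac r rs N mN N0).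
by congr (P _); apply/seteqP; split => w /=; rewrite nth_traj.
Qed.

Lemma ae_dynamics s i : (s < t)%N -> iid_until s ->
  {ae P, forall w, Z i s.+1 w = drift (traj s (Z i) w) + xi i s w}.
Proof.
move=> st iid; have [law _ _] := iid.
have := ae_eq_mean_field_average BB' BB0' (path_law_ac iid).
move/(ae_preimage (mu := P) (f := traj s (Z i)) (nu := path_law s)).
have mt : measurable_fun setT (traj s (Z i)) by [].
move=> /(_ mt) h; have {}h := h (fun N mN N0 => etrans (law i N mN) N0).
apply: filterS2 (dynamics process i st) h => w -> ->.
by rewrite /drift nth_traj.
Qed.

Lemma sigmaG_traj s i (C : set (s.+1.-tuple Rd)) : measurable C ->
  sigmaG Z s (traj s (Z i) @^-1` C).
Proof.
move=> mC; apply: sub_sigma_algebra; exists i => //.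
by exists C => //; rewrite setTI.
Qed.

Lemma sub_sigmaG_F s : sigmaG Z s `<=` sigmaF Z A s.
Proof. by move=> S GS; apply: sub_sigma_algebra; left. Qed.

Lemma path_noise_rectangle s : (s < t)%N -> iid_until s ->
  forall (C : 'I_k -> set (s.+1.-tuple Rd)) (D : 'I_k -> set Rd),
  (forall i, measurable (C i)) -> (forall i, measurable (D i)) ->
  P (\bigcap_i (traj s (Z i) @^-1` C i `&` xi i s @^-1` D i)) =
  (\prod_i (path_law s (C i) * nu (D i)))%E.
Proof.
move=> st [law ind _] C D mC mD.
pose xis w : k.-tuple Rd := [tuple xi i s w | i < k].
pose E : set (k.-tuple Rd) := \bigcap_(i in [set: 'I_k]) ((fun x => tnth x i) @^-1` D i).
have mE : measurable E.
  apply: fin_bigcap_measurable; first exact: finite_finset.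
  by move=> i _; apply: measurable_preimage => //; exact: measurable_tnth.
have FG : sigmaF Z A s (\bigcap_i (traj s (Z i) @^-1` C i)).
  apply: sub_sigmaG_F; apply: g_sigma_algebra_bigcap => i _.
  exact: sigmaG_traj.
have := noise_independent_of_past process st mE FG.
rewrite ind// => e.
have -> : \bigcap_i (traj s (Z i) @^-1` C i `&` xi i s @^-1` D i) =
   xis @^-1` E `&` (\bigcap_i (traj s (Z i) @^-1` C i)).
  apply/seteqP; split => [w h|w [h1 h2] i _]; last first.
    by split; [exact: h2|have := h1 i I; rewrite /= tnth_mktuple].
  split=> i _; last by case: (h i I).
  by rewrite /= tnth_mktuple; case: (h i I).
rewrite e; under [in RHS]eq_bigr do rewrite muleC.
rewrite big_split/=; congr (_ * _)%E; last first.
  by apply: eq_bigr => i _; exact: law.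
(* The noises are independent jointly over particles and times; [setT] at the times other than [s]
   extracts the time slice [s]. *)
pose D' (q : 'I_k * 'I_t) := if val q.2 == s then D q.1 else setT.
have mD' q : measurable (D' q) by rewrite /D'; case: ifP.
have := noise_independent process mD'.
have -> : \bigcap_(q in [set: 'I_k * 'I_t]) ((xi q.1 q.2 : T -> Rd) @^-1` D' q) = xis @^-1` E.
  apply/seteqP; split => [w h i _|w h [i r] _] /=.
    rewrite tnth_mktuple; have := h (i, Ordinal st) I.
    by rewrite /D'/= eqxx.
  rewrite /D'/=; case: eqP => // ->.
  by have := h i I; rewrite /= tnth_mktuple.
move=> ->.
rewrite -(pair_bigA _ (fun (i : 'I_k) (r : 'I_t) => P (xi i r @^-1` D' (i, r))))/=.
apply: eq_bigr => i _; rewrite (bigD1 (Ordinal st))//= big1 ?mule1.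
  by rewrite /D'/= eqxx; exact: (noise_law process i st).
move=> r rs; rewrite /D'/=; rewrite -val_eqE/= in rs.
by rewrite (negbTE rs) preimage_setT probability_setT.
Qed.

Definition path_step s (q : s.+1.-tuple Rd * Rd) : s.+2.-tuple Rd :=
  [tuple of rcons q.1 (drift q.1 + q.2)].

Lemma measurable_path_step s : measurable_fun setT (@path_step s).
Proof.
apply/measurable_fun_tnthP => i.
have [is_|is_] := ltnP i s.+1.
  rewrite (_ : _ \o _ = (fun x => tnth x (Ordinal is_)) \o fst).
    by apply: measurableT_comp => //; exact: measurable_tnth.
  by apply/funext => q /=; rewrite !(tnth_nth 0)/= nth_rcons size_tuple is_.
rewrite (_ : _ \o _ = fun q => drift q.1 + q.2); last first.
  apply/funext => q /=; rewrite (tnth_nth 0)/= nth_rcons size_tuple ltnNge is_/=.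
  by rewrite (_ : val i = s.+1) ?eqxx//; apply/eqP; rewrite eqn_leq is_ -ltnS ltn_ord.
apply: measurable_fun_matrix => a b; under eq_fun do rewrite mxE.
apply: measurable_funD; apply: (measurableT_comp (measurable_entry a b)) => //.
exact: (measurableT_comp (@measurable_drift s)).
Qed.

Lemma ae_path_step s i : (s < t)%N -> iid_until s ->
  {ae P, forall w, traj s.+1 (Z i) w = path_step (traj s (Z i) w, xi i s w)}.
Proof.
move=> st iid; apply: filterS (ae_dynamics i st iid) => w Zs.
apply: eq_from_tnth => j; rewrite tnth_mktuple (tnth_nth 0)/= nth_rcons size_tuple card_ord.
have [js|js] := ltnP j s.+1; first by rewrite nth_traj.
have -> : val j = s.+1 by apply/eqP; rewrite eqn_leq js -ltnS ltn_ord.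
by rewrite eqxx -Zs.
Qed.

Lemma ae_eq_path_event s i (E : set (s.+2.-tuple Rd)) : (s < t)%N ->
  iid_until s -> {ae P, forall w, (traj s.+1 (Z i) @^-1` E) w <->
    ((fun w => (traj s (Z i) w, xi i s w)) @^-1` (@path_step s @^-1` E)) w}.
Proof.
by move=> st iid; apply: filterS (ae_path_step i st iid) => w /= ->.
Qed.

Lemma ae_forall_fin (I : finType) (Q : I -> T -> Prop) :
  (forall i, {ae P, forall w, Q i w}) -> {ae P, forall w, forall i, Q i w}.
Proof.
move=> h; have := ae_foralln (mu := P)
  (P := fun n w => forall i, enum_rank i = n :> nat -> Q i w).
move=> h'; have {h'} : {ae P, forall w, forall n i, enum_rank i = n :> nat -> Q i w}.
  apply: h' => n; have [nI|nI] := ltnP n #|I|; last first.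
    by apply: aeW => w i e; have := ltn_ord (enum_rank i); rewrite e ltnNge nI.
  apply: filterS (h (enum_val (Ordinal nI))) => w + i e.
  by rewrite (_ : enum_val _ = i)// -[RHS]enum_rankK; congr enum_val; exact: val_inj.
by apply: filterS => w h' i; exact: (h' (enum_rank i)).
Qed.

Lemma iid_untilS s : (s < t)%N -> iid_until s -> iid_until s.+1.
Proof.
move=> st iid; have rect := path_noise_rectangle st iid.
have mt i : measurable_fun setT (traj s (Z i)) by [].
have mx i : measurable_fun setT (xi i s) by [].
have plaw := pair_law (fun i => mt i) (fun i => mx i) rect.
have pind := independent_pairs (fun i => mt i) (fun i => mx i) rect.
have mE (E : set (s.+2.-tuple Rd)) : measurable E -> measurable (@path_step s @^-1` E).
  by move=> mE; apply: measurable_preimage mE; exact: measurable_path_step.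
have mp i : measurable_fun setT (fun w => (traj s (Z i) w, xi i s w)).
  exact: measurable_fun_pair.
have lawE i (E : set (s.+2.-tuple Rd)) : measurable E ->
    P (traj s.+1 (Z i) @^-1` E) = (path_law s \x nu)%E (@path_step s @^-1` E).
  move=> mEE; rewrite -(plaw i)//; last exact: mE.
  apply: ae_eq_measure; last exact: ae_eq_path_event.
    exact: measurable_preimage.
  by apply: measurable_preimage; [exact: mp|exact: mE].
split.
- by move=> i E mEE; rewrite lawE// -(lawE i1).
- move=> E mEE.
  have := pind _ (fun i => mE _ (mEE i)).
  have -> : (\prod_i P ((fun w => (traj s (Z i) w, xi i s w)) @^-1` (@path_step s @^-1` E i)) =
      \prod_i P (traj s.+1 (Z i) @^-1` E i))%E.
    by apply: eq_bigr => i _; rewrite lawE// -(plaw i)//; exact: mE.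
  move=> <-; apply: ae_eq_measure.
  + apply: fin_bigcap_measurable; first exact: finite_finset.
    by move=> i _; exact: measurable_preimage.
  + apply: fin_bigcap_measurable; first exact: finite_finset.
    by move=> i _; apply: measurable_preimage; [exact: mp|exact: mE].
  + have := ae_forall_fin (fun i => ae_eq_path_event i (E i) st iid).
    by apply: filterS => w h; split => H i _; apply/h; exact: H.
- move=> r; rewrite leq_eqVlt => /predU1P[->|rs]; last by case: iid => _ _; exact.
  move=> N mN N0.
  pose E := [set q : s.+1.-tuple Rd * Rd | N (drift q.1 + q.2)].
  have mdn : measurable_fun setT (fun q : s.+1.-tuple Rd * Rd => drift q.1 + q.2).
    apply: measurable_fun_matrix => a b; under eq_fun do rewrite mxE.
    apply: measurable_funD; apply: (measurableT_comp (measurable_entry a b)) => //.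
    exact: (measurableT_comp (@measurable_drift s)).
  have mEE : measurable E by exact: measurable_preimage mN.
  have -> : P (Z i1 s.+1 @^-1` N) = P ((fun w => (traj s (Z i1) w, xi i1 s w)) @^-1` E).
    apply: ae_eq_measure.
    + exact: measurable_preimage.
    + by apply: measurable_preimage mEE; exact: mp.
    + by apply: filterS (ae_dynamics i1 st iid) => w /= ->.
  rewrite plaw//.
  (* Given the path [x], the new position is the noise translated by [drift x]. Translations
     preserve Lebesgue null sets and [nu] is absolutely continuous, so every section of [E] is
     null. *)
  apply/(product_measure1_eq0 (path_law s) nu mEE); apply: aeW => x.
  have : nu (+%R (drift x) @^-1` N) = 0%E.
    move/null_content_dominatesP: nu_ac; apply; last exact: lebesgue_rV_translation.
    apply: measurable_preimage mN; apply: measurable_fun_matrix => a b.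
    under eq_fun do rewrite mxE.
    by apply: measurable_funD => //; exact: measurable_entry.
  by move=> <-; congr (nu _); apply/seteqP; split => y; rewrite /xsection/= inE.
Qed.

Lemma iid_until0 : iid_until 0.
Proof.
pose one (x : Rd) : 1.-tuple Rd := [tuple x].
have mone : measurable_fun setT one.
  apply/measurable_fun_tnthP => i; rewrite (_ : _ \o _ = id)//.
  by apply/funext => x; rewrite /= [i]ord1.
have trajE i : traj 0 (Z i) = one \o Z i 0%N :> (T -> _).
  by apply/funext => w; apply: eq_from_tnth => j; rewrite tnth_mktuple [j]ord1.
have law i (E : set (1.-tuple Rd)) : measurable E ->
    P (traj 0 (Z i) @^-1` E) = mu0 (one @^-1` E).
  move=> mE; rewrite trajE comp_preimage.
  by apply: (init_law process); exact: measurable_preimage mE.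
split.
- by move=> i E mE; rewrite law// -(law i1).
- move=> E mE; under eq_bigcapr do rewrite trajE comp_preimage.
  rewrite (init_independent process); last by move=> i; exact: measurable_preimage.
  by apply: eq_bigr => i _; rewrite trajE comp_preimage.
- move=> r; rewrite leqn0 => /eqP -> N mN N0.
  rewrite (init_law process)//.
  by move/null_content_dominatesP: mu0_ac; apply.
Qed.

Lemma iid_path s : (s <= t)%N -> iid_until s.
Proof.
elim: s => [_|s ih st]; first exact: iid_until0.
exact/iid_untilS/ih/ltnW.
Qed.

(** * Measurability and inclusions for the sigma-algebras of the process *)

Lemma sigma_algebra_G s : sigma_algebra setT (sigmaG Z s).
Proof. exact: sigma_algebra_sigma_rvs. Qed.

Lemma sigma_algebra_F s : sigma_algebra setT (sigmaF Z A s).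
Proof. exact: sigma_algebra_sigma_join. Qed.

Lemma sigma_algebra_GA s : sigma_algebra setT (sigmaGA Z A s).
Proof.
case: s => [|s]; first exact: sigma_algebra_sigma_rvs.
exact: sigma_algebra_sigma_join.
Qed.

Lemma sigma_algebra_H s : sigma_algebra setT (sigmaH Z A s).
Proof.
case: s => [|s]; first exact: sigma_algebra_sigma_rvs.
exact: sigma_algebra_sigma_join.
Qed.

Lemma measurable_Z_G i r s : (r <= s)%N -> (sigmaG Z s).-measurable_fun (Z i r).
Proof.
have /measurable_fun_traj h := sigma_rvs_measurable (fun i => traj s (Z i)) i.
exact: h.
Qed.

Lemma measurable_Z_F i r s : (r <= s)%N -> (sigmaF Z A s).-measurable_fun (Z i r).
Proof.
move=> rs; apply: (sub_measurable_fun (sigma_algebra_G s) (sigma_algebra_F s)).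
  exact: sigma_joinl.
exact: measurable_Z_G.
Qed.

Lemma measurable_A_F i j r s : (r <= s)%N -> (sigmaF Z A s).-measurable_fun (A i j r).
Proof.
have /measurable_fun_traj h :=
  sigma_rvs_measurable (fun e : 'I_k * 'I_k => traj s (A e.1 e.2)) (i, j).
move=> /h; apply: (sub_measurable_fun _ (sigma_algebra_F s)).
  exact: sigma_algebra_sigma_rvs.
exact: sigma_joinr.
Qed.

Lemma measurable_Z_GA i r s : (r <= s)%N -> (sigmaGA Z A s).-measurable_fun (Z i r).
Proof.
case: s => [|s] rs.
  move: rs; rewrite leqn0 => /eqP ->.
  exact: (sigma_rvs_measurable (fun i => Z i 0%N) i).
apply: (sub_measurable_fun (sigma_algebra_G s.+1) (sigma_algebra_GA s.+1)).
  exact: sigma_joinl.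
exact: measurable_Z_G.
Qed.

Lemma measurable_A_GA i j r s : (r < s)%N -> (sigmaGA Z A s).-measurable_fun (A i j r).
Proof.
case: s => // s; rewrite ltnS.
have /measurable_fun_traj h :=
  sigma_rvs_measurable (fun e : 'I_k * 'I_k => traj s (A e.1 e.2)) (i, j).
move=> /h; apply: (sub_measurable_fun _ (sigma_algebra_GA s.+1)).
  exact: sigma_algebra_sigma_rvs.
exact: sigma_joinr.
Qed.

Lemma measurable_Z_H i s : (sigmaH Z A s).-measurable_fun (Z i s).
Proof.
case: s => [|s]; first exact: (sigma_rvs_measurable (fun i => Z i 0%N) i).
have := sigma_rvs_measurable (fun i => Z i s.+1) i.
apply: (sub_measurable_fun _ (sigma_algebra_H s.+1)).
  exact: sigma_algebra_sigma_rvs.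
exact: sigma_joinl.
Qed.

Lemma measurable_A_H i j s : (sigmaH Z A s.+1).-measurable_fun (A i j s).
Proof.
have := sigma_rvs_measurable (fun e : 'I_k * 'I_k => A e.1 e.2 s) (i, j).
apply: (sub_measurable_fun _ (sigma_algebra_H s.+1)).
  exact: sigma_algebra_sigma_rvs.
exact: sigma_joinr.
Qed.

Lemma sub_sigma_G G s : sigma_algebra setT G ->
  (forall i r, (r <= s)%N -> G.-measurable_fun (Z i r)) -> sigmaG Z s `<=` G.
Proof.
move=> sG h; apply: sub_sigma_rvs => // i; apply/measurable_fun_traj.
exact: h.
Qed.

Lemma sub_sigma_F G s : sigma_algebra setT G ->
  (forall i r, (r <= s)%N -> G.-measurable_fun (Z i r)) ->
  (forall i j r, (r <= s)%N -> G.-measurable_fun (A i j r)) ->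
  sigmaF Z A s `<=` G.
Proof.
move=> sG hZ hA; apply: sub_sigma_join => //; first exact: sub_sigma_G.
by apply: sub_sigma_rvs => // e; apply/measurable_fun_traj; exact: hA.
Qed.

Lemma sub_sigma_GA G s : sigma_algebra setT G ->
  (forall i r, (r <= s)%N -> G.-measurable_fun (Z i r)) ->
  (forall i j r, (r < s)%N -> G.-measurable_fun (A i j r)) ->
  sigmaGA Z A s `<=` G.
Proof.
move=> sG; case: s => [|s] hZ hA.
  by apply: sub_sigma_rvs => // i; exact: hZ.
apply: sub_sigma_join => //; first exact: sub_sigma_G.
by apply: sub_sigma_rvs => // e; apply/measurable_fun_traj; exact: hA.
Qed.

Lemma sub_sigma_H G s : sigma_algebra setT G ->
  (forall i, G.-measurable_fun (Z i s)) ->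
  (forall i j, (0 < s)%N -> G.-measurable_fun (A i j s.-1)) ->
  sigmaH Z A s `<=` G.
Proof.
move=> sG; case: s => [|s] hZ hA; first exact: sub_sigma_rvs.
apply: sub_sigma_join => //; first exact: sub_sigma_rvs.
by apply: sub_sigma_rvs => // e; exact: hA.
Qed.

Lemma sigmaG_GA s : sigmaG Z s `<=` sigmaGA Z A s.
Proof.
apply: sub_sigma_G; first exact: sigma_algebra_GA.
by move=> i r rs; exact: measurable_Z_GA.
Qed.

Lemma sigmaH_GA s : sigmaH Z A s `<=` sigmaGA Z A s.
Proof.
apply: sub_sigma_H; first exact: sigma_algebra_GA.
  by move=> i; exact: measurable_Z_GA.
by move=> i j s0; apply: measurable_A_GA; rewrite ltn_predL.
Qed.

Lemma sigmaGA_F s : sigmaGA Z A s `<=` sigmaF Z A s.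
Proof.
apply: sub_sigma_GA; first exact: sigma_algebra_F.
  by move=> i r rs; exact: measurable_Z_F.
by move=> i j r /ltnW rs; exact: measurable_A_F.
Qed.

Lemma sigmaF_mono r s : (r <= s)%N -> sigmaF Z A r `<=` sigmaF Z A s.
Proof.
move=> rs; apply: sub_sigma_F; first exact: sigma_algebra_F.
  by move=> i u ur; apply: measurable_Z_F; exact: leq_trans rs.
by move=> i j u ur; apply: measurable_A_F; exact: leq_trans rs.
Qed.

Lemma sigmaF_measurable s : sigmaF Z A s `<=` measurable.
Proof.
have mE : <<s (@measurable _ T) >> = @measurable _ T.
  by apply: sigma_algebra_id; exact: sigma_algebra_measurable.
apply: sub_sigma_F; first exact: sigma_algebra_measurable.
  by move=> i r _ _ E mE'; rewrite setTI /measurable/= mE; exact: measurable_preimage mE'.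
by move=> i j r _ _ E mE'; rewrite setTI /measurable/= mE; exact: measurable_preimage mE'.
Qed.

Lemma sigmaGA_measurable s : sigmaGA Z A s `<=` measurable.
Proof. by move=> E /sigmaGA_F /sigmaF_measurable. Qed.

Lemma sigmaG_measurable s : sigmaG Z s `<=` measurable.
Proof. by move=> E /sigmaG_GA /sigmaGA_measurable. Qed.

Lemma sigmaH_measurable s : sigmaH Z A s `<=` measurable.
Proof. by move=> E /sigmaH_GA /sigmaGA_measurable. Qed.

(** * Borel versions along the paths of two distinct particles *)

Lemma path_pair_law s i j : (s <= t)%N -> i != j ->
  forall N, measurable N ->
  P ((fun w => (traj s (Z i) w, traj s (Z j) w)) @^-1` N) =
  (path_law s \x path_law s)%E N.
Proof.
move=> st ij N mN; have [law ind _] := iid_path st.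
have mp : measurable_fun setT (fun w => (traj s (Z i) w, traj s (Z j) w)).
  exact: measurable_fun_pair.
pose p : {mfun T >-> (s.+1.-tuple Rd * s.+1.-tuple Rd)%type} := mfun_Sub (mem_set mp).
rewrite [RHS](product_measure_unique (m' := distribution P p))// => C D mC mD.
pose E l := if l == i then C else if l == j then D else setT.
have mE l : measurable (E l) by rewrite /E; case: ifP => // _; case: ifP.
have := ind _ mE.
rewrite (bigD1 i)//= (bigD1 j) 1?eq_sym//= big1 ?mule1; last first.
  move=> l /andP[li lj]; rewrite /E (negbTE li) (negbTE lj).
  by rewrite preimage_setT probability_setT.
have Ei : E i = C by rewrite /E eqxx.
have Ej : E j = D by rewrite /E eq_sym (negbTE ij) eqxx.
rewrite Ei Ej !law// => <-.
congr (P _); apply/seteqP; split => [w [Cw Dw] l _|w h].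
  by rewrite /E; case: eqVneq => [->//|_]; case: eqVneq => [->|].
by split; [rewrite -Ei; exact: h|rewrite -Ej; exact: h].
Qed.

Lemma ae_path_pair s i j (Q : s.+1.-tuple Rd * s.+1.-tuple Rd -> Prop) :
  (s <= t)%N -> i != j ->
  {ae (path_law s \x path_law s)%E, forall q, Q q} ->
  {ae P, forall w, Q (traj s (Z i) w, traj s (Z j) w)}.
Proof.
move=> st ij; apply: ae_preimage; first exact: measurable_fun_pair.
by move=> N mN N0; exact: (etrans (path_pair_law st ij mN)).
Qed.

Lemma ae_eq_Btraj_paths s i j : (s <= t)%N -> i != j ->
  {ae P, forall w, Btraj B B0 s (traj s (Z i) w) (traj s (Z j) w) =
    Btraj B' B0' s (traj s (Z i) w) (traj s (Z j) w)}.
Proof.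
move=> st ij.
have := ae_path_pair st ij (ae_eq_Btraj BB' BB0' (path_law_ac (iid_path st))).
by apply: filterS => w; exact.
Qed.

Lemma ae_eq_edge_prob s i j : (s <= t)%N -> i != j ->
  {ae P, forall w, edge_prob B B0 Z A i j s w = edge_prob B' B0' Z A i j s w}.
Proof.
move=> st ij.
have := ae_path_pair st ij (ae_eq_connection BB' BB0' (path_law_ac (iid_path st))).
apply: filterS => w /= []; case: s st => [_ _|s st h _] /=.
  by rewrite !nth_traj.
by have := h s.+1 (A i j s w) (leqnn _); rewrite !nth_traj.
Qed.

(* [past] stands for the state of the edge at time [s.-1]; it is irrelevant at
   time [0]. *)
Definition transition i j s (past : bool) (w : T) : R :=
  match s with
  | 0 => B0' (Z i 0%N w) (Z j 0%N w)
  | _.+1 => B' past (Z i s w) (Z j s w)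
  end.

Lemma edge_probE i j s w :
  edge_prob B' B0' Z A i j s w = transition i j s (A i j s.-1 w) w.
Proof. by case: s. Qed.

Lemma transition01 i j s a w : 0 <= transition i j s a w <= 1.
Proof. by case: s => [|s] /=. Qed.

Lemma measurable_transition G i j s a :
  (forall i, G.-measurable_fun (Z i s)) ->
  G.-measurable_fun (transition i j s a).
Proof.
move=> mZ; have mp : G.-measurable_fun (fun w => (Z i s w, Z j s w)).
  exact: measurable_fun_pair.
case: s mZ mp => [|s] mZ mp; first exact: (measurableT_comp mB0' mp).
exact: (measurableT_comp (mB' a) mp).
Qed.

Lemma measurable_edge_prob G i j s : (forall i, G.-measurable_fun (Z i s)) ->
  ((0 < s)%N -> G.-measurable_fun (A i j s.-1)) ->
  G.-measurable_fun (edge_prob B' B0' Z A i j s).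
Proof.
case: s => [|s] mZ mA; first exact: (measurable_transition i j false mZ).
have := mA isT => {}mA.
have mb b : G.-measurable_fun (fun w => (A i j s w == b)%:R : R).
  exact: (measurableT_comp (measurable_from_bool (fun a : bool => (a == b)%:R : R)) mA).
rewrite (_ : edge_prob _ _ _ _ _ _ _ = fun w =>
    (A i j s w == true)%:R * transition i j s.+1 true w +
    (A i j s w == false)%:R * transition i j s.+1 false w).
  apply: measurable_funD; apply: measurable_funM;
    by [exact: mb | exact: measurable_transition].
apply/funext => w /=; case: (A i j s w) => /=.
  by rewrite mul1r mul0r addr0.
by rewrite mul1r mul0r add0r.
Qed.

Lemma edge_prob01 i j s w : 0 <= edge_prob B' B0' Z A i j s w <= 1.
Proof. by rewrite edge_probE transition01. Qed.

Lemma measurable_fun_sigmaF d' (U : measurableType d') (f : T -> U) s :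
  (sigmaF Z A s).-measurable_fun f -> measurable_fun setT f.
Proof. by apply: measurable_fun_g_sigma; exact: sigmaF_measurable. Qed.

Lemma normr_le1 (x : R) : 0 <= x <= 1 -> `|x| <= 1.
Proof. by move=> /andP[x0 x1]; rewrite ger0_norm. Qed.

Lemma measurable_edge_prob_F i j s :
  (sigmaF Z A s).-measurable_fun (edge_prob B' B0' Z A i j s).
Proof.
apply: measurable_edge_prob => [l|s0]; first exact: measurable_Z_F.
by apply: measurable_A_F; exact: leq_pred.
Qed.

Lemma measurable_edge_value_F i j s :
  (sigmaF Z A s).-measurable_fun (edge_value A i j s : T -> R).
Proof.
apply: (measurableT_comp (measurable_from_bool (fun a : bool => a%:R : R))).
exact: measurable_A_F.
Qed.

Lemma integrable01 s (f : T -> R) : (sigmaF Z A s).-measurable_fun f ->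
  (forall w, 0 <= f w <= 1) -> P.-integrable setT (EFin \o f).
Proof.
move=> mf f01; apply: (@integrable_bounded _ _ _ P _ 1) => [|w].
  exact: measurable_fun_sigmaF mf.
exact: normr_le1.
Qed.

Lemma edge_value01 i j s w : 0 <= (edge_value A i j s w : R) <= 1.
Proof. by rewrite /edge_value; case: (A i j s w); rewrite ?lexx ler01. Qed.

(** The form in which the edge law is used below: the version supplied by [edge_law] equals the edge
    probability of the Borel kernels almost surely, because the two particles are distinct. *)
Lemma Rintegral_edge_law s i j F : (s <= t)%N -> i != j -> sigmaGA Z A s F ->
  \int[P]_(w in F) edge_value A i j s w =
  \int[P]_(w in F) edge_prob B' B0' Z A i j s w.
Proof.
move=> st ij GF; have mF := sigmaGA_measurable GF.
have [V [mV iV VF EV]] := edge_law process ij st.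
transitivity (\int[P]_(w in F) V w); first by rewrite /Rintegral (VF F GF).
rewrite -(Rintegral_indicM P V mF) -(Rintegral_indicM P (edge_prob B' B0' Z A i j s) mF).
have mVT : measurable_fun setT V by apply/measurable_EFinP; case/integrableP : iV.
apply: ae_eq_Rintegral.
- by apply: measurable_funM => //; exact: measurable_indic.
- apply: measurable_funM; last exact: measurable_indic.
  by apply: measurable_fun_sigmaF; exact: measurable_edge_prob_F.
- by apply: filterS2 EV (ae_eq_edge_prob st ij) => w <- ->.
Qed.

(** * Fresh noise and the passage to later path sigma-algebras *)

Definition noise s (w : T) : k.-tuple Rd := [tuple xi i s w | i < k].

Lemma measurable_noise s : measurable_fun setT (noise s).
Proof.
apply/measurable_fun_tnthP => i; rewrite (_ : _ \o _ = xi i s)//.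
by apply/funext => w /=; rewrite tnth_mktuple.
Qed.

Lemma Rintegral_noise s (D : T -> R) c (E : set (k.-tuple Rd)) S : (s < t)%N ->
  (sigmaF Z A s).-measurable_fun D -> (forall w, `|D w| <= c) ->
  measurable E -> sigmaF Z A s S ->
  \int[P]_(w in S `&` noise s @^-1` E) D w =
  fine (P (noise s @^-1` E)) * \int[P]_(w in S) D w.
Proof.
move=> st mD Dc mE FS; set p := fine _.
have mN : measurable (noise s @^-1` E).
  exact: measurable_preimage (@measurable_noise s) mE.
have mS := sigmaF_measurable FS.
(* The centered noise indicator has zero integral over [sigmaF] by independence, and [D] takes the
   role of the bounded weight in [Rintegral0_mul_set]. *)
pose N w : R := \1_(noise s @^-1` E) w - p.
have iE : P.-integrable setT (EFin \o (\1_(noise s @^-1` E) : T -> R)).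
  apply: (@integrable_bounded _ _ _ P _ 1) => // w.
  by rewrite indicE ger0_norm//; case: (_ \in _).
have ip : P.-integrable setT (EFin \o (cst p : T -> R)).
  exact: finite_measure_integrable_cst.
have iN : P.-integrable setT (EFin \o N) by exact: (integrableB measurableT iE ip).
have N0 F : sigmaF Z A s F -> \int[P]_(w in F) N w = 0.
  move=> FF; have mF := sigmaF_measurable FF.
  rewrite RintegralB//; [|exact: integrableS iE|exact: integrableS ip].
  rewrite Rintegral_cst// /Rintegral integral_indic//.
  apply/eqP; rewrite subr_eq0; apply/eqP.
  transitivity (fine (P (noise s @^-1` E) * P F)%E).
    by congr fine; exact: (noise_independent_of_past process st mE FF).
  rewrite fineM//.
    exact: fin_num_measure.
  exact: fin_num_measure.
have := Rintegral0_mul_set (sigma_algebra_F s) (@sigmaF_measurable s) iN N0 mD Dc FS.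
have mDT := measurable_fun_sigmaF mD.
have iD : P.-integrable setT (EFin \o D) by exact: integrable_bounded mDT Dc.
have iDN : P.-integrable setT (EFin \o (fun w => D w * \1_(noise s @^-1` E) w)).
  apply: (@integrable_mul_bounded _ _ _ P _ _ 1) => // w.
  by rewrite indicE ger0_norm//; case: (_ \in _).
rewrite (_ : \int[P]_(w in S) (N w * D w) =
    \int[P]_(w in S) (D w * \1_(noise s @^-1` E) w - p * D w)); last first.
  by apply: eq_Rintegral => w _; rewrite /N; ring.
rewrite RintegralB//; [|exact: integrableS iDN|]; last first.
  apply: integrableS (@integrableZl _ _ _ P _ measurableT p _ iD) => //.
rewrite RintegralZl//; last exact: integrableS iD.
move/eqP; rewrite subr_eq0 => /eqP <-.
rewrite -(Rintegral_indicM P _ mS) -(Rintegral_indicM P D (measurableI _ _ mS mN)).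
by apply: eq_Rintegral => w _; rewrite indicI/=; ring.
Qed.

(* Up to null events, [sigmaG s.+1] lies in the sigma-algebra of the paths until
   [s] and of the noise at [s], and that noise is independent of [sigmaF s]. *)
Lemma innovationS s (D : T -> R) c : (s < t)%N ->
  (sigmaF Z A s).-measurable_fun D -> (forall w, `|D w| <= c) ->
  (forall S, sigmaG Z s S -> \int[P]_(w in S) D w = 0) ->
  forall S, sigmaG Z s.+1 S -> \int[P]_(w in S) D w = 0.
Proof.
move=> st mD Dc D0.
have mDT := measurable_fun_sigmaF mD.
have iD : P.-integrable setT (EFin \o D) by exact: integrable_bounded mDT Dc.
(* A pi-system on which [Rintegral_noise] computes the integral of [D]: the probability of the noise
   event times the integral over the path event, hence zero. *)
pose C : set_system T := [set S | exists GE : set T * set (k.-tuple Rd),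
  [/\ sigmaG Z s GE.1, measurable GE.2 & S = GE.1 `&` noise s @^-1` GE.2]].
have sG := sigma_algebra_G s.
have GF S : sigmaG Z s S -> sigmaF Z A s S by exact: sub_sigmaG_F.
have GT : sigmaG Z s setT by rewrite -setC0 -setTD; case: sG => G0 GC _; exact: GC.
have Cm : C `<=` measurable.
  move=> _ [[G E] [/= GG mE ->]]; apply: measurableI.
    exact: sigmaG_measurable GG.
  exact: measurable_preimage (@measurable_noise s) mE.
have C0 S : <<s C >> S -> \int[P]_(w in S) D w = 0.
  apply: Rintegral0_dynkin => //; [|exact: D0|].
  - move=> _ _ [[G E] [/= GG mE ->]] [[G' E'] [/= GG' mE' ->]].
    exists (G `&` G', E `&` E'); split => /=; [|exact: measurableI|].
      have := @measurableI _ (g_sigma_algebraType (sigmaG Z s)) G G'.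
      by rewrite /measurable/= (sigma_algebra_id sG); exact.
    by rewrite preimage_setI setIACA.
  - move=> _ [[G E] [/= GG mE ->]].
    by rewrite (Rintegral_noise st mD Dc mE (GF _ GG)) D0// mulr0.
have mZC i : C.-measurable_fun (traj s (Z i)).
  move=> _ E mE; rewrite setTI; apply: sub_sigma_algebra.
  exists (traj s (Z i) @^-1` E, setT) => /=; split => //; last by rewrite setIT.
  exact: sigmaG_traj.
have mxiC i : C.-measurable_fun (xi i s).
  move=> _ E mE; rewrite setTI; apply: sub_sigma_algebra.
  exists (setT, (fun x => tnth x i) @^-1` E) => /=; split => //.
    by apply: measurable_preimage mE; exact: measurable_tnth.
  by rewrite setTI; apply/seteqP; split => w /=; rewrite tnth_mktuple.
pose step := @path_step s.
have mst : measurable_fun setT step by exact: measurable_path_step.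
suff sub : sigmaG Z s.+1 `<=` [set S | exists2 S', <<s C >> S' &
    {ae P, forall w, setT w -> (S w <-> S' w)}].
  move=> S GS; have [S' CS' SS'] := sub _ GS.
  rewrite (ae_eq_Rintegral_set (S' := S') iD) ?C0//.
  - exact: sigmaG_measurable GS.
  - exact: g_sigma_algebra_sub CS'.
  - by apply: filterS SS' => w; exact.
apply: smallest_sub.
  by apply: ae_sigma_algebra; exact: smallest_sigma_algebra.
move=> _ [i _ [E mE <-]]; rewrite setTI.
exists ((fun w => (traj s (Z i) w, xi i s w)) @^-1` (step @^-1` E)).
  have mp : C.-measurable_fun (fun w => (traj s (Z i) w, xi i s w)).
    exact: measurable_fun_pair.
  have := mp measurableT _ (measurable_preimage mst mE).
  by rewrite setTI.
have := ae_eq_path_event i E st (iid_path (ltnW st)).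
by apply: filterS => w + _.
Qed.

(** The single step iterates because [sigmaF] increases with time, so [D] stays measurable for the
    past at each later time. *)
Lemma innovation r s (D : T -> R) c : (r <= s)%N -> (s <= t)%N ->
  (sigmaF Z A r).-measurable_fun D -> (forall w, `|D w| <= c) ->
  (forall S, sigmaG Z r S -> \int[P]_(w in S) D w = 0) ->
  forall S, sigmaG Z s S -> \int[P]_(w in S) D w = 0.
Proof.
elim: s => [|s ih]; first by rewrite leqn0 => /eqP ->.
rewrite leq_eqVlt => /predU1P[->|rs] st mD Dc D0; first exact: D0.
apply: (innovationS st _ Dc); last exact: ih (ltnW st) mD Dc D0.
apply: (sub_measurable_fun (sigma_algebra_F r)).
- exact: sigma_algebra_F.
- exact: sigmaF_mono.
- exact: mD.
Qed.

(** * The probability of an edge given the paths *)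

Definition path_prob i j s (w : T) : R :=
  Btraj B' B0' s (traj s (Z i) w) (traj s (Z j) w).

Lemma measurable_path_prob i j s : (sigmaG Z s).-measurable_fun (path_prob i j s).
Proof.
have mt l : (sigmaG Z s).-measurable_fun (traj s (Z l)).
  by apply/measurable_fun_traj => r rs; exact: measurable_Z_G.
have mp : (sigmaG Z s).-measurable_fun (fun w => (traj s (Z i) w, traj s (Z j) w)).
  exact: measurable_fun_pair.
exact: (measurableT_comp (measurable_Btraj (leqnn s) mB' mB0') mp).
Qed.

Lemma sigmaG_measurable_fun_F d' (U : measurableType d') (f : T -> U) s :
  (sigmaG Z s).-measurable_fun f -> (sigmaF Z A s).-measurable_fun f.
Proof.
by apply: (sub_measurable_fun (sigma_algebra_G s) (sigma_algebra_F s)); exact: sub_sigmaG_F.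
Qed.

Lemma path_prob01 i j s w : 0 <= path_prob i j s w <= 1.
Proof. exact: Btraj01. Qed.

Lemma integrable_edge_value i j s :
  P.-integrable setT (EFin \o (edge_value A i j s : T -> R)).
Proof.
apply: (@integrable01 s); last exact: edge_value01.
exact: measurable_edge_value_F.
Qed.

Lemma integrable_edge_prob i j s :
  P.-integrable setT (EFin \o edge_prob B' B0' Z A i j s).
Proof.
apply: (@integrable01 s); last exact: edge_prob01.
exact: measurable_edge_prob_F.
Qed.

Lemma integrable_path_prob i j s : P.-integrable setT (EFin \o path_prob i j s).
Proof.
apply: (@integrable01 s); last exact: path_prob01.
by apply: sigmaG_measurable_fun_F; exact: measurable_path_prob.
Qed.

Lemma Rintegral_path_prob s i j F : (s <= t)%N -> i != j -> sigmaG Z s F ->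
  \int[P]_(w in F) edge_value A i j s w = \int[P]_(w in F) path_prob i j s w.
Proof.
elim: s F => [|s ih] F st ij GF.
  rewrite (Rintegral_edge_law)//; last first.
    exact: sigmaG_GA.
  by apply: eq_Rintegral => w _; rewrite /path_prob /= !nth_traj.
rewrite (Rintegral_edge_law)//; last first.
  exact: sigmaG_GA.
(* As the transition is affine in the preceding state, [edge_prob - path_prob] at time [s.+1] is
   [D * W]: the error at time [s] times the slope. [innovation] brings the zero integrals of [D] to
   [sigmaG s.+1], for which [W] is measurable. *)
pose D w := edge_value A i j s w - path_prob i j s w.
pose W w := transition i j s.+1 true w - transition i j s.+1 false w.
have ie := integrable_edge_value i j s; have ip := integrable_path_prob i j s.
have iD : P.-integrable setT (EFin \o D) by exact: (integrableB measurableT ie ip).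
have D1 w : `|D w| <= 1.
  have /andP[e0 e1] := edge_value01 i j s w.
  have /andP[p0 p1] := path_prob01 i j s w.
  by rewrite /D ler_norml; apply/andP; split; lra.
have mD : (sigmaF Z A s).-measurable_fun D.
  apply: measurable_funB; first exact: measurable_edge_value_F.
  by apply: sigmaG_measurable_fun_F; exact: measurable_path_prob.
have D0 S : sigmaG Z s.+1 S -> \int[P]_(w in S) D w = 0.
  apply: (innovation (leqnSn s) st mD D1).
  move=> S' GS'; have mS' := sigmaG_measurable GS'.
  rewrite RintegralB//; [|exact: integrableS ie|exact: integrableS ip].
  by rewrite (ih _ (ltnW st) ij GS') subrr.
have W1 w : `|W w| <= 1.
  have /andP[e0 e1] := transition01 i j s.+1 true w.
  have /andP[p0 p1] := transition01 i j s.+1 false w.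
  by rewrite /W ler_norml; apply/andP; split; lra.
have mW : (sigmaG Z s.+1).-measurable_fun W.
  by apply: measurable_funB; apply: measurable_transition => // l; exact: measurable_Z_G.
have := Rintegral0_mul_set (sigma_algebra_G s.+1) (@sigmaG_measurable s.+1) iD D0 mW W1 GF.
have mF := sigmaG_measurable GF.
rewrite (_ : \int[P]_(w in F) (D w * W w) =
    \int[P]_(w in F) (edge_prob B' B0' Z A i j s.+1 w - path_prob i j s.+1 w)); last first.
  apply: eq_Rintegral => w _.
  rewrite /D /W /edge_value /path_prob /= /Bhat !nth_traj//.
  rewrite (@Btraj_congr _ _ _ _ s (traj s.+1 (Z i) w) (traj s.+1 (Z j) w)
    (traj s (Z i) w) (traj s (Z j) w)); last 2 first.
    by move=> r rs; rewrite !nth_traj// leqW.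
    by move=> r rs; rewrite !nth_traj// leqW.
  by case: (A i j s w) => /=; ring.
rewrite RintegralB//.
- by move/eqP; rewrite subr_eq0 => /eqP.
- apply: (@integrableS _ _ _ P setT) => //.
  exact: integrable_edge_prob.
- apply: (@integrableS _ _ _ P setT) => //.
  exact: integrable_path_prob.
Qed.

Lemma condexp_path_prob s i j : (s <= t)%N -> i != j ->
  condexp_eq P (sigmaG Z s) (edge_value A i j s)
    (fun w => Btraj B B0 s (traj s (Z i) w) (traj s (Z j) w)).
Proof.
move=> st ij; apply: (condexp_eqI (V := path_prob i j s)
  (sigma_algebra_G s) (@sigmaG_measurable s)).
- exact: integrable_edge_value.
- exact: integrable_path_prob.
- exact: measurable_path_prob.
- by move=> S GS; rewrite Rintegral_path_prob.
- exact: (ae_eq_Btraj_paths).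
Qed.

(** * The joint law of the edges given the past *)

Lemma edges_neq (e : 'I_k * 'I_k) : edges e -> e.1 != e.2.
Proof. by rewrite /edges/= => e12; rewrite -val_eqE/= ltn_eqF. Qed.

Definition edge_event_prob (E : 'I_k * 'I_k -> set bool) e s w :=
  bernoulli_event (E e) (edge_prob B' B0' Z A e.1 e.2 s w).

Lemma edge_event_prob01 E e s w : 0 <= edge_event_prob E e s w <= 1.
Proof. by apply: bernoulli_event01; exact: edge_prob01. Qed.

Lemma measurable_edge_event_prob G E e s :
  (forall i, G.-measurable_fun (Z i s)) ->
  ((0 < s)%N -> forall i j, G.-measurable_fun (A i j s.-1)) ->
  G.-measurable_fun (edge_event_prob E e s).
Proof.
move=> mZ mA; apply: measurable_bernoulli_event.
by apply: measurable_edge_prob => // s0; exact: mA.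
Qed.

Lemma measurable_edge_event_prob_GA E e s :
  (sigmaGA Z A s).-measurable_fun (edge_event_prob E e s).
Proof.
apply: measurable_edge_event_prob => [i|s0 i j]; first exact: measurable_Z_GA.
by apply: measurable_A_GA; rewrite ltn_predL.
Qed.

Lemma measurable_fun_sigmaGA d' (U : measurableType d') (f : T -> U) s :
  (sigmaGA Z A s).-measurable_fun f -> measurable_fun setT f.
Proof. by apply: measurable_fun_g_sigma; exact: sigmaGA_measurable. Qed.

Lemma integrable_indic_event (S : set T) : measurable S ->
  P.-integrable setT (EFin \o (\1_S : T -> R)).
Proof.
move=> mS; apply: (@integrable_bounded _ _ _ P _ 1) => [|w].
  exact: measurable_indic.
by rewrite indicE ger0_norm//; case: (_ \in _).
Qed.

Lemma measurable_edge_event e s (E : 'I_k * 'I_k -> set bool) :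
  measurable (A e.1 e.2 s @^-1` E e).
Proof. by apply: measurable_preimage. Qed.

Lemma measurable_bigcap_edge_event s (E : 'I_k * 'I_k -> set bool) :
  measurable (\bigcap_(e in [set e | edges e]) (A e.1 e.2 s @^-1` E e)).
Proof.
apply: fin_bigcap_measurable; first exact: finite_finset.
by move=> e _; exact: measurable_edge_event.
Qed.

Lemma Rintegral_edge_event s e E F : (s <= t)%N -> edges e -> sigmaGA Z A s F ->
  \int[P]_(w in F) \1_(A e.1 e.2 s @^-1` E e) w =
  \int[P]_(w in F) edge_event_prob E e s w.
Proof.
move=> st /edges_neq ee GF; have mF := sigmaGA_measurable GF.
have iv := integrable_edge_value e.1 e.2 s.
have ip := integrable_edge_prob e.1 e.2 s.
have ie : P.-integrable setT (EFin \o edge_event_prob E e s).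
  apply: (@integrable_bounded _ _ _ P _ 1) => [|w].
    by apply: measurable_fun_sigmaGA; exact: measurable_edge_event_prob_GA.
  by apply: normr_le1; exact: edge_event_prob01.
have iA := integrable_indic_event (measurable_edge_event e s E).
apply/eqP; rewrite -subr_eq0 -RintegralB//; [|exact: integrableS iA|exact: integrableS ie].
pose D w := edge_value A e.1 e.2 s w - edge_prob B' B0' Z A e.1 e.2 s w.
apply/eqP; transitivity (\int[P]_(w in F) ((\1_(E e) true - \1_(E e) false) * D w)).
  by apply: eq_Rintegral => w _; rewrite indic_preimage -bernoulli_event_nat bernoulli_eventB.
have iD : P.-integrable setT (EFin \o D) by exact: (integrableB measurableT iv ip).
rewrite RintegralZl//; last exact: integrableS iD.
rewrite RintegralB//; [|exact: integrableS iv|exact: integrableS ip].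
rewrite (Rintegral_edge_law st ee GF).
by rewrite subrr mulr0.
Qed.

(** The common target of the three structures. Its right-hand integrand is [sigmaH]-measurable, so
    taking [F] in [sigmaH] gives conditional independence given [sigmaH]. *)
Definition edge_event_identity s := forall (E : 'I_k * 'I_k -> set bool) F,
  sigmaGA Z A s F ->
  \int[P]_(w in F) \1_(\bigcap_(e in [set e | edges e]) (A e.1 e.2 s @^-1` E e)) w =
  \int[P]_(w in F) \prod_(e | edges e) edge_event_prob E e s w.

(** Trades the factors [Q], which need not be measurable, for [G]-measurable versions that can be
    integrated and compared by [condexp_unique]. *)
Lemma cond_independentE (J : finType) (p : pred J) G d' (U : measurableType d')
    (X : J -> T -> U) (E : J -> set U) : sigma_algebra setT G ->
  (forall j, measurable (E j)) -> cond_independent P p G X ->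
  exists (V : J -> T -> R) (W : T -> R),
    [/\ forall j, p j -> [/\ G.-measurable_fun (V j),
          P.-integrable setT (EFin \o V j)
        & forall S, G S -> \int[P]_(w in S) V j w =
            \int[P]_(w in S) \1_(X j @^-1` E j) w],
        P.-integrable setT (EFin \o W),
        forall S, G S -> \int[P]_(w in S) W w =
          \int[P]_(w in S) \1_(\bigcap_(j in [set j | p j]) (X j @^-1` E j)) w
      & {ae P, forall w, W w = \prod_(j | p j) V j w}].
Proof.
move=> sig mE /(_ E mE) [Q [QE /(condexp_eqE sig) [W [mW iW WE QW]]]].
have /choice [V VE] : forall j, exists V : T -> R, p j ->
    [/\ G.-measurable_fun V, P.-integrable setT (EFin \o V),
      forall S, G S -> \int[P]_(w in S) V w = \int[P]_(w in S) \1_(X j @^-1` E j) w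
    & {ae P, forall w, Q j w = V w}].
  move=> j; have [pj|pj] := boolP (p j); last by exists (cst 0).
  by have [V VE] := condexp_eqE sig (QE j pj); exists V.
exists V, W; split => //; first by move=> j pj; case: (VE j pj).
have : {ae P, forall w, forall j, p j -> Q j w = V j w}.
  apply: ae_forall_fin => j; have [pj|pj] := boolP (p j); last exact: aeW.
  by have [_ _ _] := VE j pj; apply: filterS.
by apply: filterS2 QW => w <- QV; exact: eq_bigr.
Qed.

Lemma ae_eq_Rintegral_on (S : set T) (f g : T -> R) : measurable S ->
  P.-integrable setT (EFin \o f) -> P.-integrable setT (EFin \o g) ->
  {ae P, forall w, f w = g w} -> \int[P]_(w in S) f w = \int[P]_(w in S) g w.
Proof.
move=> mS fi gi fg; rewrite -(Rintegral_indicM P f mS) -(Rintegral_indicM P g mS).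
apply: ae_eq_Rintegral.
- apply: measurable_funM; last exact: measurable_indic.
  by apply/measurable_EFinP; case/integrableP : fi.
- apply: measurable_funM; last exact: measurable_indic.
  by apply/measurable_EFinP; case/integrableP : gi.
- by apply: filterS fg => w ->.
Qed.

Lemma integrable_edge_event_prob E e s :
  P.-integrable setT (EFin \o edge_event_prob E e s).
Proof.
apply: (@integrable_bounded _ _ _ P _ 1) => [|w].
  by apply: measurable_fun_sigmaGA; exact: measurable_edge_event_prob_GA.
by apply: normr_le1; exact: edge_event_prob01.
Qed.

Lemma integrable_prod_edge_event_prob E s :
  P.-integrable setT (EFin \o (fun w => \prod_(e | edges e) edge_event_prob E e s w)).
Proof.
apply: (@integrable_bounded _ _ _ P _ 1) => [|w].
  apply: measurable_bigprod => e _.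
  by apply: measurable_fun_sigmaGA; exact: measurable_edge_event_prob_GA.
by apply: normr_le1; apply: prod01 => e _; exact: edge_event_prob01.
Qed.

(** Uniqueness of conditional expectations identifies the unspecified factors of structure (a) with
    [edge_event_prob]. *)
Lemma edge_event_identity_a s : (s <= t)%N ->
  cond_independent P (@edges k) (sigmaGA Z A s) (fun e => A e.1 e.2 s) ->
  edge_event_identity s.
Proof.
move=> st ci E F GF; have mF := sigmaGA_measurable GF.
have mE (e : 'I_k * 'I_k) : measurable (E e) by [].
have [V [W [VE iW WE WV]]] := cond_independentE (sigma_algebra_GA s) mE ci.
rewrite -WE//; apply: ae_eq_Rintegral_on => //.
  exact: integrable_prod_edge_event_prob.
have : {ae P, forall w, forall e, edges e -> V e w = edge_event_prob E e s w}.
  apply: ae_forall_fin => e; have [ee|ee] := boolP (edges e); last exact: aeW.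
  have [mV iV EV] := VE e ee.
  have : {ae P, forall w, V e w = edge_event_prob E e s w}.
    apply: (condexp_unique (sigma_algebra_GA s) (@sigmaGA_measurable s)) => //.
    - exact: integrable_edge_event_prob.
    - exact: measurable_edge_event_prob_GA.
    - by move=> S GS; rewrite EV// Rintegral_edge_event.
  by apply: filterS => w + _.
by apply: filterS2 WV => w -> VE'; exact: eq_bigr.
Qed.

Lemma transition_congr i j s a b w : ((0 < s)%N -> a = b) ->
  transition i j s a w = transition i j s b w.
Proof. by case: s => // s ->. Qed.

Section fixed_time.
Context (s : nat) (st : (s <= t)%N) (E : 'I_k * 'I_k -> set bool).

Definition past (e : 'I_k * 'I_k) (w : T) : s.-tuple bool :=
  [tuple A e.1 e.2 r w | r < s].

(** With the past frozen at [y] the transition depends on positions alone and becomes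
    [sigmaG]-measurable. The default [false] is read when [s] is 0, where [transition] ignores the
    past. *)
Definition past_prob (y : s.-tuple bool) e w : R :=
  bernoulli_event (E e) (transition e.1 e.2 s (nth false y s.-1) w).

Lemma past_probE y e w : past e w = y -> past_prob y e w = edge_event_prob E e s w.
Proof.
move=> <-; rewrite /past_prob /edge_event_prob edge_probE.
congr bernoulli_event; apply: transition_congr => s0.
have us : (s.-1 < s)%N by rewrite ltn_predL.
by rewrite -[X in nth _ _ X]/(val (Ordinal us)) -tnth_nth tnth_mktuple.
Qed.

Lemma past_prob01 y e w : 0 <= past_prob y e w <= 1.
Proof. by apply: bernoulli_event01; exact: transition01. Qed.

Lemma measurable_past_prob y e : (sigmaG Z s).-measurable_fun (past_prob y e).
Proof.
apply: measurable_bernoulli_event; apply: measurable_transition => // i.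
exact: measurable_Z_G.
Qed.

(** The past before [s], encoded as a set of whole trajectories until [t], since these are the
    variables made independent by (b) and (c). *)
Definition past_cylinder (y : s.-tuple bool) : set (t.+1.-tuple bool) :=
  \bigcap_(r in [set: 'I_s]) [set c | nth false c r = tnth y r].

Lemma measurable_past_cylinder y : measurable (past_cylinder y).
Proof.
apply: fin_bigcap_measurable; first exact: finite_finset.
move=> r _; have rt : (r <= t)%N by apply: leq_trans st; exact: ltnW.
exact: (measurable_preimage (E := [set tnth y r]) (measurable_tuple_nth false rt)).
Qed.

Lemma past_eventE e y :
  [set w | past e w = y] = traj t (A e.1 e.2) @^-1` past_cylinder y.
Proof.
apply/seteqP; split => w /= h; last first.
  apply: eq_from_tnth => r; rewrite tnth_mktuple -(h r)// nth_traj//.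
  by apply: leq_trans st; exact: ltnW.
move=> r _ /=; rewrite nth_traj; last by apply: leq_trans st; exact: ltnW.
by rewrite -h tnth_mktuple.
Qed.

Lemma measurable_past e y : measurable [set w | past e w = y].
Proof.
by rewrite past_eventE; apply: measurable_preimage => //; exact: measurable_past_cylinder.
Qed.

Lemma sigmaGA_past e y : sigmaGA Z A s [set w | past e w = y].
Proof.
have -> : [set w | past e w = y] =
    \bigcap_(r in [set: 'I_s]) (A e.1 e.2 r @^-1` [set tnth y r]).
  apply/seteqP; split => [w <- r _|w h] /=; first by rewrite tnth_mktuple.
  by apply: eq_from_tnth => r; rewrite tnth_mktuple; exact: h.
rewrite -(sigma_algebra_id (sigma_algebra_GA s)); apply: g_sigma_algebra_bigcap => r _.
rewrite -[X in _ X]setTI; apply: measurable_A_GA => //; exact: ltn_ord.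
Qed.

(** Over an event of [sigmaG s] this is the edge law, tested on the intersection of the event with
    the given past, which lies in [sigmaGA s]. The difference [D] is [sigmaF s]-measurable, so
    [innovation] extends the identity to [sigmaG t]. *)
Lemma Rintegral_past_event e y S : edges e -> sigmaG Z t S ->
  \int[P]_(w in S) (\1_(A e.1 e.2 s @^-1` E e) w * \1_[set w | past e w = y] w) =
  \int[P]_(w in S) (past_prob y e w * \1_[set w | past e w = y] w).
Proof.
move=> ee GS.
pose D w := \1_(A e.1 e.2 s @^-1` E e) w * \1_[set w | past e w = y] w -
  past_prob y e w * \1_[set w | past e w = y] w.
have GAF d' (U : measurableType d') (f : T -> U) :
    (sigmaGA Z A s).-measurable_fun f -> (sigmaF Z A s).-measurable_fun f.
  apply: (sub_measurable_fun (sigma_algebra_GA s) (sigma_algebra_F s)).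
  exact: sigmaGA_F.
have mpast : (sigmaF Z A s).-measurable_fun (\1_[set w | past e w = y] : T -> R).
  apply: GAF; apply: (measurable_indic (T := g_sigma_algebraType (sigmaGA Z A s))).
  by rewrite /measurable/= (sigma_algebra_id (sigma_algebra_GA s)); exact: sigmaGA_past.
have mA : (sigmaF Z A s).-measurable_fun (\1_(A e.1 e.2 s @^-1` E e) : T -> R).
  apply: (measurable_indic (T := g_sigma_algebraType (sigmaF Z A s))).
  by rewrite -[X in measurable X]setTI; apply: measurable_A_F.
have mq : (sigmaF Z A s).-measurable_fun (past_prob y e).
  apply: (sub_measurable_fun (sigma_algebra_G s) (sigma_algebra_F s)).
    exact: sub_sigmaG_F.
  exact: measurable_past_prob.
have m1 := measurable_funM mA mpast; have m2 := measurable_funM mq mpast.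
have indic01 (V : set T) w : 0 <= (\1_V w : R) <= 1.
  by rewrite indicE; case: (_ \in _); rewrite ?lexx ler01.
have b1 w : `|\1_(A e.1 e.2 s @^-1` E e) w * \1_[set w | past e w = y] w : R| <= 1.
  apply: normr_le1; have /andP[? ?] := indic01 (A e.1 e.2 s @^-1` E e) w.
  have /andP[? ?] := indic01 [set w | past e w = y] w.
  by rewrite mulr_ge0//= mulr_ile1.
have b2 w : `|past_prob y e w * \1_[set w | past e w = y] w| <= 1.
  apply: normr_le1; have /andP[? ?] := past_prob01 y e w.
  have /andP[? ?] := indic01 [set w | past e w = y] w.
  by rewrite mulr_ge0//= mulr_ile1.
have i1' := integrable_bounded P (measurable_fun_sigmaF m1) b1.
have i2' := integrable_bounded P (measurable_fun_sigmaF m2) b2.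
have D2 w : `|D w| <= 1 + 1.
  by rewrite (le_trans (ler_normB _ _))// lerD// ?b1// ?b2.
have mD : (sigmaF Z A s).-measurable_fun D by exact: measurable_funB m1 m2.
apply/eqP; rewrite -subr_eq0 -RintegralB//; last 3 first.
- exact: sigmaG_measurable GS.
- by apply: integrableS i1' => //; exact: sigmaG_measurable GS.
- by apply: integrableS i2' => //; exact: sigmaG_measurable GS.
apply/eqP; apply: (innovation st (leqnn t) mD D2) => //.
move=> S' GS'; have mS' := sigmaG_measurable GS'.
have GAS' : sigmaGA Z A s (S' `&` [set w | past e w = y]).
  have := @measurableI _ (g_sigma_algebraType (sigmaGA Z A s)) S' [set w | past e w = y].
  rewrite /measurable/= (sigma_algebra_id (sigma_algebra_GA s)).
  by apply; [exact: sigmaG_GA|exact: sigmaGA_past].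
have := Rintegral_edge_event E st ee GAS'.
have iA := integrable_indic_event (measurable_edge_event e s E).
have ip := integrable_edge_event_prob E e s.
move/eqP; rewrite -subr_eq0 -RintegralB//; last 3 first.
- exact: sigmaGA_measurable GAS'.
- by apply: integrableS iA => //; exact: sigmaGA_measurable GAS'.
- by apply: integrableS ip => //; exact: sigmaGA_measurable GAS'.
move=> /eqP <-; rewrite -(Rintegral_indicM P _ mS').
rewrite -(Rintegral_indicM P _ (sigmaGA_measurable GAS')).
apply: eq_Rintegral => w _; rewrite indicI /D.
have [pw|pw] := pselect (past e w = y).
  by rewrite /= [\1_[set _ | past e _ = y] w]indicE mem_set// (past_probE pw) !mulr1.
by rewrite /= [\1_[set _ | past e _ = y] w]indicE memNset// !mulr0 subr0 mul0r.
Qed.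

Definition past_set (y : {ffun 'I_k * 'I_k -> s.-tuple bool}) : set T :=
  \bigcap_(e in [set e | edges e]) [set w | past e w = y e].

Lemma measurable_past_set y : measurable (past_set y).
Proof.
apply: fin_bigcap_measurable; first exact: finite_finset.
by move=> e _; exact: measurable_past.
Qed.

(* Both structures (b) and (c) provide the hypothesis. Given [sigmaG t], the
   event of the edge [e] has probability [past_prob] times that of its past, and
   the factor [past_prob] is [sigmaG t]-measurable. *)
Lemma Rintegral_past_set y S : 
  cond_independent P (@edges k) (sigmaG Z t) (fun e => traj t (A e.1 e.2)) ->
  sigmaG Z t S ->
  \int[P]_(w in S) (\1_(\bigcap_(e in [set e | edges e]) (A e.1 e.2 s @^-1` E e)) w *
    \1_(past_set y) w) =
  \int[P]_(w in S) ((\prod_(e | edges e) past_prob (y e) e w) * \1_(past_set y) w).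
Proof.
move=> ci GS; have mS := sigmaG_measurable GS.
have mC' (e : 'I_k * 'I_k) := measurable_past_cylinder (y e).
pose C (e : 'I_k * 'I_k) := [set c : t.+1.-tuple bool | E e (nth false c s)] `&`
  past_cylinder (y e).
have mC e : measurable (C e).
  apply: measurableI; last exact: mC'.
  exact: (measurable_preimage (E := E e) (measurable_tuple_nth false st)).
have CE e : traj t (A e.1 e.2) @^-1` C e =
    (A e.1 e.2 s @^-1` E e) `&` [set w | past e w = y e].
  rewrite past_eventE preimage_setI; congr (_ `&` _).
  by apply/seteqP; split => w /=; rewrite nth_traj.
(* Independence is applied twice: to the past together with time [s], and to the past alone. Edge by
   edge the factors differ by [past_prob] ([VV']), so the products differ by [q]. *)
have [V [W [VE iW WE WV]]] := cond_independentE (sigma_algebra_G t) mC ci.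
have [V' [W' [VE' iW' WE' WV']]] := cond_independentE (sigma_algebra_G t) mC' ci.
pose q w := \prod_(e | edges e) past_prob (y e) e w.
have mqe e : (sigmaG Z t).-measurable_fun (past_prob (y e) e).
  apply: (sub_measurable_fun (sigma_algebra_G s) (sigma_algebra_G t)); last first.
    exact: measurable_past_prob.
  apply: sub_sigma_G; first exact: sigma_algebra_G.
  by move=> i r rs; apply: measurable_Z_G; exact: leq_trans st.
have mq : (sigmaG Z t).-measurable_fun q by apply: measurable_bigprod => e _.
have q01 w : 0 <= q w <= 1 by apply: prod01 => e _; exact: past_prob01.
have q1 w := normr_le1 (q01 w).
have GT (f : T -> R) : (sigmaG Z t).-measurable_fun f -> measurable_fun setT f.
  by apply: measurable_fun_g_sigma; exact: sigmaG_measurable.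
have pullout (f h : T -> R) (g : T -> R) F : (sigmaG Z t).-measurable_fun g ->
    (forall w, `|g w| <= 1) -> P.-integrable setT (EFin \o f) ->
    P.-integrable setT (EFin \o h) ->
    (forall F, sigmaG Z t F -> \int[P]_(w in F) f w = \int[P]_(w in F) h w) ->
    sigmaG Z t F -> \int[P]_(w in F) (g w * f w) = \int[P]_(w in F) (g w * h w).
  move=> mg g1 fi hi fh GF; have mF := sigmaG_measurable GF.
  have ifh : P.-integrable setT (EFin \o (fun w => f w - h w)).
    exact: (integrableB measurableT fi hi).
  have fh0 F' : sigmaG Z t F' -> \int[P]_(w in F') (f w - h w) = 0.
    move=> GF'; have mF' := sigmaG_measurable GF'.
    rewrite RintegralB//; [|exact: integrableS fi|exact: integrableS hi].
    by rewrite fh// subrr.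
  have := Rintegral0_mul_set (sigma_algebra_G t) (@sigmaG_measurable t) ifh fh0 mg g1 GF.
  have gfi := integrable_mul_bounded fi (GT _ mg) g1.
  have ghi := integrable_mul_bounded hi (GT _ mg) g1.
  under eq_Rintegral do rewrite mulrBl.
  rewrite RintegralB//; [|exact: integrableS gfi|exact: integrableS ghi].
  move/eqP; rewrite subr_eq0 => /eqP e.
  transitivity (\int[P]_(w in F) (f w * g w)).
    by apply: eq_Rintegral => w _; rewrite mulrC.
  by rewrite e; apply: eq_Rintegral => w _; rewrite mulrC.
have iC' e : P.-integrable setT
    (EFin \o (\1_(traj t (A e.1 e.2) @^-1` past_cylinder (y e)) : T -> R)).
  by apply: integrable_indic_event; exact: measurable_preimage (mC' e).
have VV' : {ae P, forall w, forall e, edges e -> V e w = past_prob (y e) e w * V' e w}.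
  apply: ae_forall_fin => e; have [ee|ee] := boolP (edges e); last exact: aeW.
  have [mV iV EV] := VE e ee; have [mV' iV' EV'] := VE' e ee.
  have qe1 w := normr_le1 (past_prob01 (y e) e w).
  suff : {ae P, forall w, V e w = past_prob (y e) e w * V' e w}.
    by apply: filterS => w + _.
  apply: (condexp_unique (sigma_algebra_G t) (@sigmaG_measurable t)) => //.
  - have := integrable_mul_bounded iV' (GT _ (mqe e)) qe1.
    by apply: eq_integrable => // w _ /=; rewrite mulrC.
  - by apply: measurable_funM.
  - move=> F GF; rewrite EV// (pullout _ _ _ _ (mqe e) qe1 iV' (iC' e) EV' GF).
    have := Rintegral_past_event (y e) ee GF; rewrite past_eventE => <-.
    by apply: eq_Rintegral => w _; rewrite CE indicI past_eventE.
have past_setE : past_set y = \bigcap_(e in [set e | edges e])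
    (traj t (A e.1 e.2) @^-1` past_cylinder (y e)).
  by apply: eq_bigcapr => e _; exact: past_eventE.
have ip : P.-integrable setT (EFin \o (\1_(\bigcap_(e in [set e | edges e])
    (traj t (A e.1 e.2) @^-1` past_cylinder (y e))) : T -> R)).
  by rewrite -past_setE; apply: integrable_indic_event; exact: measurable_past_set.
rewrite past_setE -(pullout _ _ _ _ mq q1 iW' ip WE' GS).
transitivity (\int[P]_(w in S) W w).
  rewrite WE//; apply: eq_Rintegral => w _; rewrite -past_setE.
  rewrite -[LHS]/((\1_(\bigcap_(e in [set e | edges e]) (A e.1 e.2 s @^-1` E e)) \*
    \1_(past_set y)) w) -indicI; congr (\1_ _ w).
  rewrite /past_set -bigcapI; apply: eq_bigcapr => e _; by rewrite CE.
apply: ae_eq_Rintegral_on => //.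
  have := integrable_mul_bounded iW' (GT _ mq) q1.
  by apply: eq_integrable => // w _ /=; rewrite mulrC.
apply: filterS3 WV WV' VV' => w -> -> VVw.
by rewrite -big_split/=; exact: eq_bigr.
Qed.

End fixed_time.

Section atoms.
Context (s : nat) (st : (s <= t)%N).

(** The constant value outside [edges] makes each atom either empty or the [past_set] prescribing
    the past of the edges. *)
Definition edge_past (w : T) : {ffun 'I_k * 'I_k -> s.-tuple bool} :=
  [ffun e => if edges e then past s e w else [tuple of nseq s false]].

Lemma edge_past_atom y : [set w | edge_past w = y] =
  if [forall e, edges e || (y e == [tuple of nseq s false])]
  then past_set y else set0.
Proof.
case: ifPn => [/forallP h|].
  apply/seteqP; split => w /=.
    by move=> <- e /= ee; rewrite ffunE ee.
  move=> wy; apply/ffunP => e; rewrite ffunE; have := h e.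
  by have [ee _|//] := boolP (edges e); [exact: wy|move=> _ /eqP ->].
rewrite negb_forall => /existsP[e]; rewrite negb_or => /andP[ee ye].
apply/seteqP; split => // w /= wy; move: ye.
by rewrite -wy ffunE (negbTE ee) eqxx.
Qed.

Lemma measurable_edge_past_atom y : measurable [set w | edge_past w = y].
Proof. by rewrite edge_past_atom; case: ifP => // _; exact: measurable_past_set. Qed.

Lemma ae_const_on_atom y i j r : (r < s)%N ->
  exists b, {ae P, forall w, edge_past w = y -> A i j r w = b}.
Proof.
move=> rs.
have lt_case (i' j' : 'I_k) : (i' < j')%N -> forall w, edge_past w = y ->
    A i' j' r w = tnth (y (i', j')) (Ordinal rs).
  by move=> ij w <-; rewrite ffunE /edges/= ij tnth_mktuple.
have rt : (r <= t)%N by apply: leq_trans st; exact: ltnW.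
case: (ltngtP i j) => [ij|ji|/val_inj <-].
- by exists (tnth (y (i, j)) (Ordinal rs)); apply: aeW; exact: lt_case.
- exists (tnth (y (j, i)) (Ordinal rs)).
  by apply: filterS (edge_sym process i j rt) => w ->; exact: lt_case.
- by exists true; apply: filterS (edge_diag process i rt) => w ->.
Qed.

(* The edges outside [edges] are a.s. determined, by symmetry and by the
   diagonal convention, so that the past of [edges] fixes all generators. *)
Lemma sigmaGA_atom y F : sigmaGA Z A s F ->
  exists2 G, sigmaG Z s G & {ae P, forall w, edge_past w = y -> (F w <-> G w)}.
Proof.
pose K := [set S : set T | exists2 S', sigmaG Z s S' &
  {ae P, forall w, [set w | edge_past w = y] w -> (S w <-> S' w)}].
have sK : sigma_algebra setT K by exact: ae_sigma_algebra (sigma_algebra_G s).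
suff h : sigmaGA Z A s `<=` K by move=> /h[G GG FG]; exists G.
have GK : sigmaG Z s `<=` K by move=> S GS; exists S => //; exact: aeW.
apply: sub_sigma_GA => // [i r rs|i j r rs].
  by apply: (sub_measurable_fun (sigma_algebra_G s) sK GK); exact: measurable_Z_G.
apply/(measurable_fun_sigmaP _ sK) => _ [E _ <-]; rewrite setTI.
have [b Ab] := ae_const_on_atom y i j rs.
have [Eb|Eb] := pselect (E b).
  exists setT.
    by rewrite -setC0 -setTD; case: (sigma_algebra_G s) => G0 GC _; exact: GC.
  by apply: filterS Ab => w h /h /= ->.
exists set0; first by case: (sigma_algebra_G s).
by apply: filterS Ab => w h /h /= ->.
Qed.

(** The integral is split along the finitely many atoms of [edge_past]. On an atom [F] agrees almost
    surely with an event of [sigmaG s], hence of [sigmaG t], to which [Rintegral_past_set] applies;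
    there [past_prob] coincides with [edge_event_prob]. *)
Lemma edge_event_identity_c :
  cond_independent P (@edges k) (sigmaG Z t) (fun e => traj t (A e.1 e.2)) ->
  edge_event_identity s.
Proof.
move=> ci E F GAF; have mF := sigmaGA_measurable GAF.
set S := \bigcap_(e in _) _.
have mS : measurable S := measurable_bigcap_edge_event s E.
have iS : P.-integrable setT (EFin \o (\1_S : T -> R)) by exact: integrable_indic_event.
have ip := integrable_prod_edge_event_prob E s.
pose p w := \prod_(e | edges e) edge_event_prob E e s w.
pose D w := \1_S w - p w.
have iD : P.-integrable setT (EFin \o D) by exact: (integrableB measurableT iS ip).
apply/eqP; rewrite -subr_eq0 -RintegralB//; [|exact: integrableS iS|exact: integrableS ip].
rewrite -/D -(Rintegral_indicM P D mF).
pose at_ y := [set w | edge_past w = y].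
have iDF y : P.-integrable setT (EFin \o (fun w => D w * (\1_F w * \1_(at_ y) w))).
  apply: (@integrable_mul_bounded _ _ _ P _ _ 1) => // [|w].
    by apply: measurable_funM; apply: measurable_indic => //; exact: measurable_edge_past_atom.
  by rewrite !indicE; case: (_ \in _); case: (_ \in _);
      rewrite /= ?mulr0 ?mul0r ?mulr1 ?normr0 ?normr1.
rewrite (_ : \int[P]_w (D w * \1_F w) =
    \int[P]_w \sum_y D w * (\1_F w * \1_(at_ y) w)); last first.
  apply: eq_Rintegral => w _; rewrite -mulr_sumr -mulr_sumr; congr (_ * _).
  rewrite (bigD1 (edge_past w))//= big1 => [|y yw].
    by rewrite addr0 [X in _ * X]indicE mem_set// mulr1.
  by rewrite indicE memNset// => /= e; rewrite e eqxx in yw.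
rewrite Rintegral_sum// big1// => y _.
have [G GG FG] := sigmaGA_atom y GAF; have mG := sigmaG_measurable GG.
have Gt : sigmaG Z t G.
  move: GG; apply: sub_sigma_G => [|i r rs]; first exact: sigma_algebra_G.
  by apply: measurable_Z_G; exact: leq_trans st.
have iDG : P.-integrable setT (EFin \o (fun w => D w * \1_(at_ y) w)).
  apply: (@integrable_mul_bounded _ _ _ P _ _ 1) => // [|w].
    by apply: measurable_indic => //; exact: measurable_edge_past_atom.
  by rewrite indicE; case: (_ \in _); rewrite /= ?normr0 ?normr1.
transitivity (\int[P]_(w in G) (D w * \1_(at_ y) w)).
  rewrite -(Rintegral_indicM P _ mG).
  apply: ae_eq_Rintegral.
  - by apply/measurable_EFinP; case/integrableP : (iDF y).
  - apply: measurable_funM; last exact: measurable_indic.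
    by apply/measurable_EFinP; case/integrableP : iDG.
  - apply: filterS FG => w h; rewrite -mulrA; congr (_ * _); rewrite mulrC.
    rewrite [\1_(at_ y) w]indicE; have [yw|yw] := pselect (at_ y w); last first.
      by rewrite memNset// !mul0r.
    rewrite mem_set// !mul1r !indicE; congr (_%:R); congr nat_of_bool.
    by apply/idP/idP; rewrite !inE => /(h yw).
rewrite /at_ edge_past_atom; case: ifP => _; last first.
  under eq_Rintegral do rewrite indic0 mulr0.
  by rewrite Rintegral_cst// mul0r.
have := Rintegral_past_set st E y ci Gt.
have mp := measurable_past_set st y.
have ind1 w : `|\1_(past_set y) w : R| <= 1.
  by rewrite indicE; case: (_ \in _); rewrite /= ?normr0 ?normr1.
pose q w := \prod_(e | edges e) past_prob E (y e) e w.
have qp w : q w * \1_(past_set y) w = p w * \1_(past_set y) w.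
  rewrite indicE; have [yw|yw] := pselect (past_set y w); last first.
    by rewrite memNset// !mulr0.
  by congr (_ * _); apply: eq_bigr => e ee; rewrite past_probE//; exact: yw.
have i1' := @integrable_mul_bounded _ _ _ P _ _ 1 iS (measurable_indic mp) ind1.
have i2' := @integrable_mul_bounded _ _ _ P _ _ 1 ip (measurable_indic mp) ind1.
rewrite -/q (_ : \int[P]_(w in G) (q w * \1_(past_set y) w) =
    \int[P]_(w in G) (p w * \1_(past_set y) w)); last first.
  by apply: eq_Rintegral => w _; exact: qp.
move/eqP; rewrite -subr_eq0 -RintegralB//; [|exact: integrableS i1'|exact: integrableS i2'].
by move=> /eqP e; rewrite -[RHS]e; apply: eq_Rintegral => w _; rewrite /D mulrBl.
Qed.

End atoms.

(** Structure (c) at the final time is the first clause of (b), so both are handled by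
    [edge_event_identity_c]. *)
Lemma edge_event_identityP s : (s <= t)%N -> edge_event_identity s.
Proof.
move=> st; have [sa|[[sb _]|sc]] := edge_structure process.
- exact: (edge_event_identity_a st (sa s st)).
- exact: (edge_event_identity_c st sb).
- exact: (edge_event_identity_c st (sc t (leqnn t))).
Qed.

(** * From the whole past to the present positions and preceding edges *)

Lemma measurable_edge_event_prob_H E e s :
  (sigmaH Z A s).-measurable_fun (edge_event_prob E e s).
Proof.
apply: measurable_edge_event_prob => // [i|]; first exact: measurable_Z_H.
by case: s => // s _ i j; exact: measurable_A_H.
Qed.

(** The versions given [sigmaGA] are functions of the present positions and the preceding edge
    states, hence [sigmaH]-measurable; tested on the smaller family of events, they remain versions
    given [sigmaH]. *)
Lemma cond_independent_H s : (s <= t)%N ->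
  cond_independent P (@edges k) (sigmaH Z A s) (fun e => A e.1 e.2 s).
Proof.
move=> st E _; exists (fun e => edge_event_prob E e s); split.
  move=> e ee; apply: (condexp_eqI (V := edge_event_prob E e s)
    (sigma_algebra_H s) (@sigmaH_measurable s)).
  - by apply: integrable_indic_event; exact: measurable_edge_event.
  - exact: integrable_edge_event_prob.
  - exact: measurable_edge_event_prob_H.
  - move=> S HS; apply/esym.
    apply: (Rintegral_edge_event) => //.
    exact: sigmaH_GA.
  - exact: aeW.
apply: (condexp_eqI (V := fun w => \prod_(e | edges e) edge_event_prob E e s w)
  (sigma_algebra_H s) (@sigmaH_measurable s)).
- by apply: integrable_indic_event; exact: measurable_bigcap_edge_event.
- exact: integrable_prod_edge_event_prob.
- by apply: measurable_bigprod => e _; exact: measurable_edge_event_prob_H.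
- by move=> S HS; apply/esym/edge_event_identityP => //; exact: sigmaH_GA.
- exact: aeW.
Qed.

Lemma condexp_edge_H s i j : (s <= t)%N -> i != j ->
  condexp_eq P (sigmaH Z A s) (edge_value A i j s) (edge_prob B B0 Z A i j s).
Proof.
move=> st ij; apply: (condexp_eqI (V := edge_prob B' B0' Z A i j s)
  (sigma_algebra_H s) (@sigmaH_measurable s)).
- exact: (integrable_edge_value).
- exact: integrable_edge_prob.
- apply: measurable_edge_prob => // [l|]; first exact: measurable_Z_H.
  by case: s {st} => // s _; exact: measurable_A_H.
- move=> S HS; apply/esym.
  apply: (Rintegral_edge_law) => //.
  exact: sigmaH_GA.
- exact: (ae_eq_edge_prob).
Qed.

End process.

Theorem corollary2p7 (R : realType) (d : nat) (d_gt0 : (0 < d)%N)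
    (gamma : R) (gamma01 : 0 < gamma < 1)
    (B : bool -> 'rV[R]_d -> 'rV[R]_d -> R) (B0 : 'rV[R]_d -> 'rV[R]_d -> R)
    (B_conn : forall a, connection_function (B a))
    (B0_conn : connection_function B0)
    (mu0 nu : probability 'rV[R]_d R)
    (mu0_ac : mu0 `<< lebesgue_rV R d) (nu_ac : nu `<< lebesgue_rV R d)
    (k : nat) (k_gt0 : (0 < k)%N) (t : nat)
    (disp : measure_display) (T : measurableType disp) (P : probability T R)
    (Z : 'I_k -> nat -> {RV P >-> 'rV[R]_d})
    (A : 'I_k -> 'I_k -> nat -> {RV P >-> bool})
    (xi : 'I_k -> nat -> {RV P >-> 'rV[R]_d})
    (process : mean_field_process gamma B B0 Z A t (Ordinal k_gt0) mu0 nu xi) :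
  [/\ mutually_independent P (fun i => traj t (Z i)) /\
      identically_distributed P (fun i => traj t (Z i)),
      forall s, (s <= t)%N ->
        cond_independent P (@edges k) (sigmaH Z A s) (fun e => A e.1 e.2 s) /\
        forall i j : 'I_k, (i < j)%N -> exists Q : T -> R,
          condexp_eq P (sigmaH Z A s) (fun w => (A i j s w)%:R) Q /\
          condexp_eq P (sigmaGA Z A s) (fun w => (A i j s w)%:R) Q
    & forall s, (s <= t)%N -> forall i j : 'I_k, (i < j)%N ->
        condexp_eq P (sigmaG Z s) (fun w => (A i j s w)%:R)
          (fun w => Btraj B B0 s (traj s (Z i) w) (traj s (Z j) w))].
Proof.
have /choice[B' B'P] : forall a : bool, exists g : 'rV[R]_d -> 'rV[R]_d -> R,
  [/\ measurable_fun setT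
    (fun z : 'rV[R]_d * 'rV[R]_d => g z.1 z.2), forall x y, 0 <= g x y <= 1
  & {ae (lebesgue_rV R d \x lebesgue_rV R d)%E,
      forall z, B a z.1 z.2 = g z.1 z.2}].
  by move=> a; exact: connection_borel.
have [B0' [mB0' B0'01 BB0']] := connection_borel B0_conn.
have mB' a : measurable_fun setT (fun z : 'rV[R]_d * 'rV[R]_d => B' a z.1 z.2).
  by have [] := B'P a.
have B'01 a x y : 0 <= B' a x y <= 1 by have [_ h _] := B'P a; exact: h.
have BB' a : {ae (lebesgue_rV R d \x lebesgue_rV R d)%E,
    forall z, B a z.1 z.2 = B' a z.1 z.2} by have [] := B'P a.
have neq (i j : 'I_k) : (i < j)%N -> i != j by move=> ij; exact: (edges_neq (e := (i, j))).
split.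
- have [law ind _] := iid_path mu0_ac nu_ac process mB' mB0' BB' BB0' (leqnn t).
  by split => // i j E mE; rewrite law// law.
- move=> s st; split.
    exact: (cond_independent_H mu0_ac nu_ac process mB' mB0' BB' BB0' B'01 B0'01).
  (* The common value is the edge probability of the original kernels; it need not be measurable, as
     [condexp_eq] asks for almost sure equality with a version. *)
  move=> i j /neq ij; exists (edge_prob B B0 Z A i j s); split.
    exact: (condexp_edge_H mu0_ac nu_ac process mB' mB0' BB' BB0' B'01 B0'01).
  exact: (edge_law process).
- move=> s st i j /neq ij.
  exact: (condexp_path_prob mu0_ac nu_ac process mB' mB0' BB' BB0' B'01 B0'01).
Qed.
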